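(* Let $K$ be a field, $S=K[x_1,\ldots,x_n]$, and let $I\subset S$ be a monomial ideal generated in degree $2$. Let $\mathcal{P}(S)$ be the set of monomial prime ideals of $S$. The following conditions are equivalent: (a) $I$ is polymatroidal. (b) For all $P\in\mathcal{P}(S)$ the ideal $I(P)$ is polymatroidal. (c) For all $P\in\mathcal{P}(S)$ the ideal $I(P)$ is generated in a single degree and has linear quotients with respect to the reverse lexicographic order of its minimal monomial generators. (d) For all $P\in\mathcal{P}(S)$ the ideal $I(P)$ has a linear resolution. (e) After relabeling of the variables there exist integers $0\leq k\leq m\leq n$ such that $$I=((x_1,\ldots,x_k)(x_1,\ldots,x_m),\, J),$$ where $J$ is a squarefree monomial ideal in the variables $x_{k+1},\ldots,x_m$ satisfying the following property: if $x_ix_j\in J$ and $k+1\leq l\leq m$ with $l\neq i,j$, then $x_ix_l\in J$ or $x_jx_l\in J$.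
   Context: For a monomial ideal $I$, $G(I)$ denotes its unique minimal set of monomial generators, and $\deg_{x_i}(u)$ is the exponent of $x_i$ in the monomial $u$. $I$ is ''generated in degree $d$'' if all elements of $G(I)$ have degree $d$, and ''generated in a single degree'' if this holds for some $d$. A monomial ideal $I$ is polymatroidal if it is generated in a single degree and, for all $u,v\in G(I)$ and every $i$ with $\deg_{x_i}(u)>\deg_{x_i}(v)$, there exists $j$ with $\deg_{x_j}(u)<\deg_{x_j}(v)$ such that $x_j(u/x_i)\in I$. Monomial prime ideals are the ideals $P_C=(x_i : i\notin C)$ for $C\subseteq[n]=\{1,\ldots,n\}$. The monomial localization $I(P_C)$ is the monomial ideal obtained from $I$ by substituting $x_i\mapsto 1$ for all $i\in C$. A monomial ideal $L$ has linear quotients with respect to an ordering $u_1,\ldots,u_m$ of $G(L)$ if for each $i=2,\ldots,m$ the colon ideal $(u_1,\ldots,u_{i-1}):u_i$ is generated by a subset of the variables. For the reverse lexicographic order, the generators are listed in decreasing order $u_1>u_2>\cdots>u_m$ with respect to the reverse lexicographic order induced by $x_1>\cdots>x_n$. A graded ideal $L$ has a linear resolution if for some $d$ it has a $d$-linear resolution, i.e. $\mathrm{Tor}_i^S(L,K)_j=0$ for all $i$ and all $j\neq i+d$. *)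

(* Defs.v *)
From HB Require Import structures.
From mathcomp Require Import all_boot all_order all_fingroup all_algebra.
From mathcomp Require Import mpoly.

Set Implicit Arguments.
Unset Strict Implicit.
Unset Printing Implicit Defensive.

Import GRing.Theory.
Local Open Scope ring_scope.

(* Ideals of S = K[x_1, ..., x_n] are predicates {mpoly K[n]} -> Prop, compared
   pointwise.  The variable x_(i+1) is 'X_i with i : 'I_n, and a monomial is
   identified with its exponent vector in 'X_{1..n}. *)

Section Ideals.
Variables (K : fieldType) (n : nat).
Implicit Types (I J L : {mpoly K[n]} -> Prop) (u v : 'X_{1..n}).

Definition same_ideal I J := forall p, I p <-> J p.

Definition gen_ideal (G : {mpoly K[n]} -> Prop) : {mpoly K[n]} -> Prop :=
  fun p => exists s : seq ({mpoly K[n]} * {mpoly K[n]}),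
    (forall t, t \in s -> G t.2) /\ p = \sum_(t <- s) t.1 * t.2.

Definition ideal_add I J : {mpoly K[n]} -> Prop :=
  fun p => exists a b, [/\ I a, J b & p = a + b].

Definition ideal_mul I J : {mpoly K[n]} -> Prop :=
  gen_ideal (fun p => exists a b, [/\ I a, J b & p = a * b]).

Definition ideal_colon I (f : {mpoly K[n]}) : {mpoly K[n]} -> Prop :=
  fun p => I (p * f).

Definition monomials_ideal (A : 'X_{1..n} -> Prop) : {mpoly K[n]} -> Prop :=
  gen_ideal (fun p => exists2 u, A u & p = 'X_[u]).

Definition var_ideal (V : {set 'I_n}) : {mpoly K[n]} -> Prop :=
  gen_ideal (fun p => exists2 i, i \in V & p = 'X_i).

Definition monomial_ideal I := exists A, same_ideal I (monomials_ideal A).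

(* G(I): the monomials of I that are minimal with respect to divisibility. *)
Definition min_gen I : 'X_{1..n} -> Prop :=
  fun u => I 'X_[u] /\ forall v, I 'X_[v] -> (v <= u)%MM -> v = u.

Definition generated_in_degree (d : nat) I :=
  forall u, min_gen I u -> mdeg u = d.

Definition generated_in_single_degree I := exists d, generated_in_degree d I.

Definition polymatroidal I :=
  [/\ monomial_ideal I, generated_in_single_degree I &
      forall u v, min_gen I u -> min_gen I v ->
      forall i : 'I_n, (v i < u i)%N ->
      exists2 j : 'I_n, (u j < v j)%N & I 'X_[(u - U_(i) + U_(j))%MM]].

(* I(P_C), where P_C = (x_i : i \notin C), as an ideal of the full ring S. *)
Definition localization I (C : {set 'I_n}) : {mpoly K[n]} -> Prop :=
  let subst := [tuple (if i \in C then 1 else 'X_i : {mpoly K[n]}) | i < n] in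
  gen_ideal (fun q => exists2 p, I p & q = p \mPo subst).

(* The order on 'X_{1..n} provided by multinomials breaks ties between
   monomials of the same degree lexicographically, so it is not this one. *)
Definition revlex_gt : rel 'X_{1..n} := fun u v =>
  (mdeg v < mdeg u)%N ||
  (mdeg u == mdeg v) &&
  [exists i : 'I_n, (u i < v i)%N &&
     [forall j : 'I_n, (i < j)%N ==> (u j == v j)]].

Definition linear_quotients_wrt L (s : seq 'X_{1..n}) :=
  [/\ uniq s, (forall u, u \in s <-> min_gen L u) &
      forall i, (0 < i < size s)%N ->
      exists V : {set 'I_n},
        same_ideal
          (ideal_colon (monomials_ideal (fun u => u \in take i s))
                       'X_[nth 0%MM s i])
          (var_ideal V)].

Definition revlex_linear_quotients L :=
  monomial_ideal L /\
  exists2 s, sorted revlex_gt s & linear_quotients_wrt L s.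

Definition homogeneous_of_degree (p : {mpoly K[n]}) (a : int) :=
  forall u, u \in msupp p -> (mdeg u)%:Z = a.

(* A graded resolution ... -> F_1 -> F_0 -> L -> 0 by free modules of finite
   rank.  F_i = \bigoplus_r S(- res_deg i r) consists of row vectors, and the
   maps act by multiplication on the right; res_diff i : F_(i+1) -> F_i. *)
Record graded_free_resolution L := GradedFreeResolution {
  res_rank : nat -> nat;
  res_deg : forall i, 'I_(res_rank i) -> int;
  res_aug : 'cV[{mpoly K[n]}]_(res_rank 0);
  res_diff : forall i, 'M[{mpoly K[n]}]_(res_rank i.+1, res_rank i);
  res_aug_homog : forall r,
    homogeneous_of_degree (res_aug r 0) (res_deg r);
  res_diff_homog : forall i r c,
    homogeneous_of_degree (res_diff i r c) (res_deg r - res_deg c);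
  res_aug_onto : forall p,
    L p <-> exists v : 'rV_(res_rank 0), p = (v *m res_aug) 0 0;
  res_exact0 : forall v : 'rV_(res_rank 0),
    v *m res_aug = 0 <-> exists w, v = w *m res_diff 0;
  res_exact : forall i (v : 'rV_(res_rank i.+1)),
    v *m res_diff i = 0 <-> exists w, v = w *m res_diff i.+1
}.

Section Tor.
Variables (L : {mpoly K[n]} -> Prop) (F : graded_free_resolution L).

(* The differentials of the complex F \otimes_S K, with K = S/(x_1,...,x_n). *)
Definition tensor_diff i : 'M[K]_(res_rank F i.+1, res_rank F i) :=
  map_mx (fun p : {mpoly K[n]} => p@_0%MM) (res_diff F i).

Definition tensor_cycle i : 'rV[K]_(res_rank F i) -> Prop :=
  match i with
  | 0 => fun _ => True
  | i'.+1 => fun v : 'rV[K]_(res_rank F i'.+1) => v *m tensor_diff i' = 0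
  end.

Definition tensor_boundary i (v : 'rV[K]_(res_rank F i)) :=
  exists w, v = w *m tensor_diff i.

(* Tor_i^S(L, K)_j = H_i(F \otimes_S K)_j = 0; the degree j part of
   F_i \otimes_S K is spanned by the basis elements of degree j. *)
Definition Tor_vanishes (i : nat) (j : int) :=
  forall v : 'rV[K]_(res_rank F i),
    (forall r, v 0 r != 0 -> res_deg r = j) ->
    tensor_cycle v -> tensor_boundary v.

End Tor.

(* Tor is computed from one graded free resolution F; for a homogeneous ideal L
   such an F always exists
   and the homology of F \otimes_S K does not depend on it. *)
Definition has_linear_resolution L :=
  exists (F : graded_free_resolution L) (d : int),
  forall (i : nat) (j : int), j <> i%:Z + d -> Tor_vanishes F i j.

(* The ideal obtained from I by a permutation of the variables. *)
Definition relabel (s : 'S_n) I : {mpoly K[n]} -> Prop :=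
  fun p => I (msym s p).

Definition squarefree_monomial_ideal_in (V : {set 'I_n}) J :=
  exists2 A, same_ideal J (monomials_ideal A) &
    forall u, A u -> forall i : 'I_n,
      (u i <= 1)%N /\ (i \notin V -> u i = 0%N).

(* The x_(k+1), ..., x_m of the mathematical notation are the 'X_i with
   k <= i < m. *)
Definition degree2_shape I :=
  exists s : 'S_n, exists k m : nat, (k <= m <= n)%N /\
  exists J, [/\
    squarefree_monomial_ideal_in [set i : 'I_n | (k <= i < m)%N] J,
    same_ideal (relabel s I)
      (ideal_add (ideal_mul (var_ideal [set i : 'I_n | (i < k)%N])
                            (var_ideal [set i : 'I_n | (i < m)%N])) J) &
    forall i j l : 'I_n, J ('X_i * 'X_j) -> (k <= l < m)%N ->
      l != i -> l != j -> J ('X_i * 'X_l) \/ J ('X_j * 'X_l)].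

End Ideals.

(* Main.v *)
Require Import Defs.
From HB Require Import structures.
From mathcomp Require Import all_boot all_order all_fingroup all_algebra.
From mathcomp Require Import mpoly.
From mathcomp Require Import zify.
From Stdlib Require Import Classical IndefiniteDescription.

(** An ideal I generated by monomials of degree 2 is a graph with loops on the
    variables: i and j are joined when x_i x_j lies in I.  All five conditions
    turn out to say that this graph satisfies [edge_join]: each vertex which
    lies on some edge is joined to one of the two ends of any given edge.  In
    other words the non-isolated vertices without loop form a complete
    multipartite graph, and those with a loop are joined to every non-isolated
    vertex.

    The exchange property of I is [edge_join] read on pairs of edges
    ([polymatroidal_edge_join], [edge_join_polymatroidal]), and the explicit
    shape is [edge_join] with the loops numbered first and the isolated vertices
    last ([degree2_shape_edge_join], [edge_join_degree2_shape]).  Localization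
    preserves it because I(P) is the unit ideal, or is generated by variables,
    or coincides with I ([edge_join_localization]).

    That a polymatroidal ideal has linear quotients holds in every degree:
    exchanging a generator u against an earlier one v at the last variable where
    they differ gives an earlier generator dividing x_j u, for a variable x_j
    that divides v : u ([polymatroidal_revlex]).

    To pass from linear quotients to a linear resolution, linear quotients are
    considered for vectors over S instead of polynomials ([linear_rows]).  The
    syzygies of generators with linear quotients are spanned by relations with
    one variable as last coordinate, and these relations have linear quotients
    again ([linear_rows_syzygies]).  Iterating yields a resolution all of whose
    maps are linear ([linear_quotients_resolution]), without any comparison of
    complexes.

    Conversely, let all localizations have linear resolutions.  The vanishing of
    Tor_0 outside one degree says that each I(P) is generated in a single degree
    ([Tor0_min_gen]).  For P leaving out one vertex c without loop, I(P) contains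
    the neighbours of c as variables, so every edge must contain a neighbour of c
    or c itself ([single_degree_edge]).  This is [edge_join], except that nothing
    is said about a vertex with a loop; there it remains to see that two loops i
    and l are joined, which holds because otherwise the relation between x_i^2
    and x_l^2 would be a minimal syzygy of degree 4, whereas Tor_1 lives in
    degree 3 ([Tor1_squares]). *)

Set Implicit Arguments.
Unset Strict Implicit.
Unset Printing Implicit Defensive.

Import GRing.Theory.
Local Open Scope ring_scope.

(** * Ideals generated by monomials *)

Section MonomialIdeals.
Variables (K : fieldType) (n : nat).
Implicit Types (I J L : {mpoly K[n]} -> Prop) (u v w : 'X_{1..n}).
Implicit Types (p q : {mpoly K[n]}) (V : {set 'I_n}).

Lemma gen_ideal0 (G : {mpoly K[n]} -> Prop) : gen_ideal G 0.
Proof. by exists [::]; split=> [t|]; rewrite ?in_nil ?big_nil. Qed.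

Lemma gen_idealD (G : {mpoly K[n]} -> Prop) p q :
  gen_ideal G p -> gen_ideal G q -> gen_ideal G (p + q).
Proof.
move=> [s [Gs ->]] [t [Gt ->]]; exists (s ++ t); rewrite big_cat; split=> // x.
by rewrite mem_cat => /orP[/Gs|/Gt].
Qed.

Lemma gen_idealM (G : {mpoly K[n]} -> Prop) p q :
  gen_ideal G q -> gen_ideal G (p * q).
Proof.
move=> [s [Gs ->]]; exists [seq (p * t.1, t.2) | t <- s]; split.
  by move=> x /mapP[t ts ->] /=; exact: Gs ts.
by rewrite big_map mulr_sumr; apply: eq_bigr => t _ /=; rewrite mulrA.
Qed.

Lemma gen_ideal_gen (G : {mpoly K[n]} -> Prop) p : G p -> gen_ideal G p.
Proof.
by move=> Gp; exists [:: (1, p)]; rewrite big_seq1 mul1r; split=> // t;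
  rewrite inE => /eqP->.
Qed.

Lemma gen_ideal_sum (G : {mpoly K[n]} -> Prop) (T : eqType) (s : seq T) (P : pred T)
    (F : T -> {mpoly K[n]}) :
  (forall x, x \in s -> P x -> gen_ideal G (F x)) ->
  gen_ideal G (\sum_(x <- s | P x) F x).
Proof.
move=> GF; rewrite big_seq_cond; apply: big_ind.
- exact: gen_ideal0.
- by move=> *; apply: gen_idealD.
- by move=> x /andP[]; apply: GF.
Qed.

Lemma gen_ideal_ext (G H : {mpoly K[n]} -> Prop) :
  (forall p, G p <-> H p) -> same_ideal (gen_ideal G) (gen_ideal H).
Proof.
by move=> GH p; split=> -[s [Gs ->]]; exists s; split=> // t /Gs /GH.
Qed.

Lemma msuppMX_mem p u w :
  reflect (exists2 v, v \in msupp p & w = (v + u)%MM)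
    (w \in msupp (p * 'X_[u])).
Proof.
rewrite (perm_mem (msuppMX p u)).
by apply: (iffP mapP) => -[v vp ->]; exists v; rewrite // addmC.
Qed.

(** Monomial ideals are governed by their monomials: because the generators
    are monomials, every term of an element is already in the ideal. *)
Lemma monomials_idealP (A : 'X_{1..n} -> Prop) p :
  monomials_ideal A p <->
  forall u, u \in msupp p -> exists2 a, A a & (a <= u)%MM.
Proof.
split=> [[s [As ->]] u | Ap].
  move/msupp_sum_le => /flatten_mapP[t].
  rewrite mem_filter /= => /As[a Aa ->] /msuppMX_mem[v _ ->].
  by exists a; rewrite // lem_addl.
rewrite [p]mpolyE; apply: gen_ideal_sum => u /Ap[a Aa le_au] _.
rewrite -mul_mpolyC -(submK le_au) mpolyXD mulrA; apply: gen_idealM.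
by apply: gen_ideal_gen; exists a.
Qed.

Lemma monomials_idealX (A : 'X_{1..n} -> Prop) u :
  monomials_ideal A 'X_[K, u] <-> exists2 a, A a & (a <= u)%MM.
Proof.
rewrite monomials_idealP msuppX; split=> [|Au v].
  by apply; rewrite inE.
by rewrite inE => /eqP->.
Qed.

Lemma var_idealE V :
  @same_ideal K n (var_ideal V)
    (monomials_ideal (fun u => exists2 i, i \in V & u = U_(i)%MM)).
Proof.
apply: gen_ideal_ext => p; split=> [[i iV ->]|[_ [i iV ->] ->]].
  by exists U_(i)%MM; first exists i.
by exists i.
Qed.

Lemma var_idealP V p :
  var_ideal V p <->
  forall u, u \in msupp p -> exists2 i, i \in V & (0 < u i)%N.
Proof.
rewrite (var_idealE V p) monomials_idealP; split=> Vp u /Vp.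
  by case=> _ [i iV ->]; rewrite lep1mP -lt0n; exists i.
by case=> i iV ui; exists U_(i)%MM; [exists i | rewrite lep1mP -lt0n].
Qed.

(** The variables in V generate a prime ideal, which contains no other
    variable. *)
Lemma var_ideal_cancel V p (x : 'I_n) :
  x \notin V -> var_ideal V (p * 'X_x) -> var_ideal V p.
Proof.
rewrite !var_idealP => xV Vp u up; have [|y yV] := Vp (u + U_(x))%MM.
  by apply/msuppMX_mem; exists u.
rewrite mnmDE mnm1E; case: eqP => [xy|_]; first by rewrite xy yV in xV.
by rewrite addn0; exists y.
Qed.

Lemma var_ideal_sum V p : var_ideal V p ->
  exists q : 'I_n -> {mpoly K[n]}, p = \sum_(x in V) q x * 'X_x.
Proof.
move=> [s [Vs ->]]; elim: s Vs => [|t s IHs] Vs.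
  by exists (fun _ => 0); rewrite big_nil big1 // => x _; rewrite mul0r.
have [|q sE] := IHs; first by move=> t' t's; apply: Vs; rewrite inE t's orbT.
have [x xV tx] := Vs t (mem_head t s).
exists (fun y => q y + (if y == x then t.1 else 0)).
rewrite big_cons sE tx addrC (bigD1 x) //= [RHS](bigD1 x) //= eqxx mulrDl -!addrA.
congr (_ + _); rewrite addrC; congr (_ + _); apply: eq_bigr => y /andP[_ /negPf->].
by rewrite addr0.
Qed.

Lemma monomial_ideal_supp L p :
  monomial_ideal L -> (L p <-> forall u, u \in msupp p -> L 'X_[u]).
Proof.
case=> A LA; rewrite (LA p) monomials_idealP.
by split=> Lp u /Lp; rewrite (LA 'X_[u]) monomials_idealX.
Qed.

Lemma monomial_ideal_up L u v :
  monomial_ideal L -> L 'X_[u] -> (u <= v)%MM -> L 'X_[v].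
Proof.
case=> A LA; rewrite (LA 'X_[u]) (LA 'X_[v]) !monomials_idealX => -[a Aa au] uv.
by exists a; rewrite // (lepm_trans au uv).
Qed.

Lemma same_monomial_ideal I J :
  monomial_ideal I -> monomial_ideal J ->
  (forall u, I 'X_[u] <-> J 'X_[u]) -> same_ideal I J.
Proof.
move=> mI mJ IJ p; rewrite (monomial_ideal_supp p mI) (monomial_ideal_supp p mJ).
by split=> Ip u /Ip /IJ.
Qed.

Lemma mdeg_le u v : (u <= v)%MM -> (mdeg u <= mdeg v)%N.
Proof. by move/submK <-; rewrite mdegD leq_addl. Qed.

Lemma lem_mdeg_eq u v : (u <= v)%MM -> mdeg u = mdeg v -> u = v.
Proof.
move=> uv; rewrite -[in mdeg v](submK uv) mdegD => e.
have /eqP: mdeg (v - u) = 0%N by lia.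
by rewrite mdeg_eq0 => /eqP vu; rewrite -(submK uv) vu add0m.
Qed.

Lemma exists_min_gen L u :
  L 'X_[u] -> exists2 v, min_gen L v & (v <= u)%MM.
Proof.
have [k] := ubnP (mdeg u); elim: k u => // k IHk u du Lu.
have [[v [Lv [vu ne_vu]]]|none] :=
  classic (exists v, L 'X_[v] /\ (v <= u)%MM /\ v <> u).
  have [|w mw wv] := IHk v _ Lv; last by exists w; rewrite // (lepm_trans wv vu).
  rewrite -ltnS; apply: leq_trans du; rewrite ltnS ltn_neqAle mdeg_le // andbT.
  by apply/eqP=> /(lem_mdeg_eq vu).
exists u; last exact: lepm_refl.
by split=> // v Lv vu; apply: NNPP => ne_vu; apply: none; exists v.
Qed.

Lemma generated_in_degree_le d L u :
  generated_in_degree d L -> L 'X_[u] -> (d <= mdeg u)%N.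
Proof. by move=> dL /exists_min_gen[v /dL <-]; apply: mdeg_le. Qed.

Lemma min_gen_degree d L u :
  generated_in_degree d L -> L 'X_[u] -> mdeg u = d -> min_gen L u.
Proof.
move=> dL Lu du; have [v mv vu] := exists_min_gen Lu.
by rewrite -(lem_mdeg_eq vu) // du; apply: dL.
Qed.

Lemma mdeg2P u : mdeg u = 2%N -> exists i j : 'I_n, u = (U_(i) + U_(j))%MM.
Proof.
move=> du; have /existsP[i ui] : [exists i, u i != 0%N].
  apply: contraT; rewrite negb_exists => /forallP u0; move: du.
  by rewrite mdegE big1 // => i _; apply/eqP; rewrite -[_ == _]negbK.
have Ui : (U_(i) <= u)%MM by rewrite lep1mP.
have /eqP/mdeg1P[j /eqP uj] : mdeg (u - U_(i)) = 1%N.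
  by move: du; rewrite -[in mdeg u](submK Ui) mdegD mdeg1; lia.
by exists i, j; rewrite -(submK Ui) uj addmC.
Qed.

End MonomialIdeals.

(** * Homogeneous components *)

Section HomogeneousComponents.
Variables (K : fieldType) (n : nat).
Local Notation S := {mpoly K[n]}.
Implicit Types (p q : S) (a b : int) (u v w : 'X_{1..n}).

(** The degree is an integer, since it will be shifted by the degrees of the
    basis elements of a resolution; the components of negative degree vanish. *)
Definition hcomp a p : S :=
  \sum_(u <- msupp p | (mdeg u)%:Z == a) p@_u *: 'X_[u].

Lemma mcoeff_hcomp a p u :
  (hcomp a p)@_u = if (mdeg u)%:Z == a then p@_u else 0.
Proof.
rewrite /hcomp -big_filter raddf_sum /=.
rewrite (eq_bigr (fun v => if v == u then p@_u else 0)); last first.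
  by move=> v _; rewrite mcoeffZ mcoeffX; case: eqP => [->|_]; rewrite ?mulr1 ?mulr0.
case: ifP => du; last first.
  rewrite big_seq big1 // => v; rewrite mem_filter.
  by move=> /andP[dv _]; case: eqP => // vu; rewrite -vu dv in du.
have [up|/memN_msupp_eq0 pu] := boolP (u \in msupp p); last first.
  by rewrite pu big1 // => v _; case: ifP.
have us : u \in [seq v <- msupp p | (mdeg v)%:Z == a] by rewrite mem_filter du.
rewrite (bigD1_seq u) ?filter_uniq ?msupp_uniq //= eqxx big1 ?addr0 //.
by move=> v /negPf->.
Qed.

Lemma hcomp_is_additive a : additive (hcomp a).
Proof.
move=> p q; apply/mpolyP=> u.
by rewrite mcoeffB !mcoeff_hcomp mcoeffB; case: ifP; rewrite ?subr0.
Qed.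

HB.instance Definition _ a := GRing.isAdditive.Build S S (hcomp a)
  (hcomp_is_additive a).

Lemma hcomp_homog a p : homogeneous_of_degree (hcomp a p) a.
Proof.
by move=> u; rewrite mcoeff_msupp mcoeff_hcomp; case: ifP => [/eqP//|_]; rewrite eqxx.
Qed.

Lemma hcomp_of_homog a b p :
  homogeneous_of_degree p b -> hcomp a p = if a == b then p else 0.
Proof.
move=> hp; apply/mpolyP=> u; rewrite mcoeff_hcomp.
have [up|/memN_msupp_eq0 pu] := boolP (u \in msupp p).
  by rewrite (hp u up) eq_sym; case: ifP; rewrite ?mcoeff0.
by rewrite pu; do 2!case: ifP; rewrite ?mcoeff0.
Qed.

Lemma homog0 a : homogeneous_of_degree (0 : S) a.
Proof. by move=> u; rewrite msupp0. Qed.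

Lemma homogN a p : homogeneous_of_degree p a -> homogeneous_of_degree (- p) a.
Proof. by move=> hp u; rewrite (perm_mem (msuppN p)); apply: hp. Qed.

Lemma homogD a p q : homogeneous_of_degree p a -> homogeneous_of_degree q a ->
  homogeneous_of_degree (p + q) a.
Proof.
by move=> hp hq u /msuppD_le; rewrite mem_cat => /orP[/hp|/hq].
Qed.

Lemma homogM a b p q : homogeneous_of_degree p a -> homogeneous_of_degree q b ->
  homogeneous_of_degree (p * q) (a + b).
Proof.
move=> hp hq u /msuppM_le/allpairsP[[v w] /= [vp wq ->]].
by rewrite mdegD PoszD (hp v vp) (hq w wq).
Qed.

Lemma homogX u : homogeneous_of_degree ('X_[u] : S) (mdeg u)%:Z.
Proof. by move=> v; rewrite msuppX inE => /eqP->. Qed.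

Lemma homogXU (i : 'I_n) : homogeneous_of_degree ('X_i : S) 1.
Proof. by have := @homogX U_(i)%MM; rewrite mdeg1. Qed.

Lemma homog_scale a c p : homogeneous_of_degree p a ->
  homogeneous_of_degree (c *: p) a.
Proof. by move=> hp u /msuppZ_le/hp. Qed.

Lemma hcompM a b p q : homogeneous_of_degree q b ->
  hcomp a (p * q) = hcomp (a - b) p * q.
Proof.
move=> hq; rewrite [p]mpolyE mulr_suml !raddf_sum mulr_suml.
apply: eq_bigr => u _; rewrite -(subrK b a) addrK.
have hu := @homog_scale _ (p@_u) _ (@homogX u).
rewrite /= (hcomp_of_homog _ (homogM hu hq)) (hcomp_of_homog _ hu).
rewrite (inj_eq (addIr b)).
by case: ifP; rewrite ?mul0r.
Qed.

Lemma hcomp_mulmx m r (v : 'rV[S]_m) (A : 'M[S]_(m, r)) a (dr : 'I_m -> int) j :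
    (forall i, homogeneous_of_degree (A i j) (dr i)) ->
  hcomp a ((v *m A) 0 j) = ((\row_i hcomp (a - dr i) (v 0 i)) *m A) 0 j.
Proof.
move=> hA; rewrite !mxE raddf_sum; apply: eq_bigr => i _.
by rewrite /= (hcompM _ _ (hA i)) mxE.
Qed.

End HomogeneousComponents.

(** * Linear quotients give linear resolutions *)

Section LinearQuotients.
Variables (K : fieldType) (n : nat).
Local Notation S := {mpoly K[n]}.
Implicit Types (p q : S) (V : {set 'I_n}).

(** The order on the rows comes from a rank function and not from their
    position: syzygies will be indexed by pairs (row, variable), in whatever
    order these are enumerated. *)
Definition span_before m r (A : 'M[S]_(m, r)) (rk : 'I_m -> nat) (N : nat)
    (g : 'rV[S]_r) :=
  exists2 c : 'rV[S]_m, (forall j, (N <= rk j)%N -> c 0 j = 0) & g = c *m A.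

Section Span.
Variables (m r : nat) (A : 'M[S]_(m, r)) (rk : 'I_m -> nat) (N : nat).
Local Notation span := (span_before A rk N).

Lemma span0 : span 0.
Proof. by exists 0; rewrite ?mul0mx // => j _; rewrite mxE. Qed.

Lemma spanD g h : span g -> span h -> span (g + h).
Proof.
move=> [c c0 ->] [d d0 ->]; exists (c + d); rewrite ?mulmxDl // => j Nj.
by rewrite mxE c0 ?d0 ?addr0.
Qed.

Lemma spanZ p g : span g -> span (p *: g).
Proof.
move=> [c c0 ->]; exists (p *: c); rewrite -?scalemxAl // => j Nj.
by rewrite mxE c0 ?mulr0.
Qed.

Lemma span_row i : (rk i < N)%N -> span (row i A).
Proof.
move=> iN; exists (delta_mx 0 i); rewrite ?rowE // => j Nj.
by rewrite mxE eqxx /=; case: eqP => // ji; move: iN; rewrite -ji ltnNge Nj.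
Qed.

Lemma span_sum (T : Type) (s : seq T) (P : pred T) F :
  (forall x, P x -> span (F x)) -> span (\sum_(x <- s | P x) F x).
Proof.
move=> sF; apply: big_ind => //; [exact: span0 | by move=> *; apply: spanD].
Qed.

End Span.

Lemma span_before_mono m r (A : 'M[S]_(m, r)) rk rk' N N' g :
    (forall i, rk i < N -> rk' i < N')%N ->
  span_before A rk N g -> span_before A rk' N' g.
Proof.
move=> le_rk [c c0 ->]; exists c => // j N'j; apply: c0.
by rewrite leqNgt; apply/negP=> /le_rk; rewrite ltnNge N'j.
Qed.

(** Generators with linear quotients, for submodules of S^r instead of ideals.
    Passing to vectors is what makes the notion stable under taking syzygies. *)
Record linear_rows (r : nat) := LinearRows {
  lr_num : nat;
  lr_mx : 'M[S]_(lr_num, r);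
  lr_rank : 'I_lr_num -> nat;
  lr_deg : int;
  lr_vars : 'I_lr_num -> {set 'I_n};
  lr_rank_inj : injective lr_rank;
  lr_homog : forall i j, homogeneous_of_degree (lr_mx i j) lr_deg;
  lr_colon : forall k p,
    span_before lr_mx lr_rank (lr_rank k) (p *: row k lr_mx) <->
    var_ideal (lr_vars k) p
}.

Section Syzygies.
Variables (r : nat) (M : linear_rows r).
Local Notation m := (lr_num M).
Local Notation A := (lr_mx M).
Local Notation rk := (@lr_rank r M).
Local Notation V := (@lr_vars r M).

Definition relation_of (kx : 'I_m * 'I_n) (c : 'rV[S]_m) :=
  kx.2 \in V kx.1 ->
  [/\ forall j, (rk kx.1 <= rk j)%N -> c 0 j = 0,
      forall j, homogeneous_of_degree (c 0 j) 1 &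
      'X_(kx.2) *: row kx.1 A = c *m A].

(** The coefficients may be taken linear because both sides are homogeneous. *)
Lemma exists_relations : exists c, forall kx, relation_of kx (c kx).
Proof.
suff /fin_all_exists[c cP] : forall kx, exists c : 'rV[S]_m, relation_of kx c.
  by exists c.
case=> k x; rewrite /relation_of /=.
have [xV|xV] := boolP (x \in V k); last by exists 0.
have [|c c0 cE] := (lr_colon k 'X_x).2.
  by apply: gen_ideal_gen; exists x.
exists (\row_j hcomp 1 (c 0 j)) => _; split=> [j /c0 cj|j|].
- by rewrite mxE cj raddf0.
- by rewrite mxE; apply: hcomp_homog.
apply/rowP=> j; rewrite mxE [row _ _ _ _]mxE.
have hk := homogM (@homogXU K n x) (@lr_homog r M k j).
have := hcomp_of_homog (1 + lr_deg M) hk; rewrite eqxx => <-.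
have -> : 'X_x * A k j = (c *m A) 0 j by rewrite -cE !mxE.
rewrite (hcomp_mulmx _ _ (fun i => @lr_homog r M i j)).
by congr ((_ *m _) 0 j); apply/rowP=> i; rewrite !mxE addrK.
Qed.

(** The syzygies of linear rows are generated by the relations which express
    that a variable multiplies a row into the span of the earlier ones; each
    has a variable as its last coordinate.  Comparing last coordinates, one
    sees that these generators have linear quotients again. *)
Lemma linear_rows_syzygies : exists N : linear_rows m,
  lr_deg N = 1 /\
  forall v : 'rV[S]_m, v *m A = 0 <-> exists w, v = w *m lr_mx N.
Proof.
have [c cP] := exists_relations.
pose T := [set kx : 'I_m * 'I_n | kx.2 \in V kx.1].
have TP (i : 'I_#|T|) : (enum_val i).2 \in V (enum_val i).1.
  by have := enum_valP i; rewrite inE.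
pose sg kx : 'rV[S]_m := 'X_(kx.2) *: delta_mx 0 kx.1 - c kx.
pose B := \matrix_(i < #|T|) sg (enum_val i).
have rowB i : row i B = sg (enum_val i) by rewrite rowK.
have sgA kx : kx.2 \in V kx.1 -> sg kx *m A = 0.
  by case/cP=> _ _ cA; rewrite mulmxBl -scalemxAl -rowE cA subrr.
have sg_lead kx : kx.2 \in V kx.1 -> sg kx 0 kx.1 = 'X_(kx.2).
  by case/cP=> c0 _ _; rewrite !mxE c0 // !eqxx mulr1 subr0.
have sg_gt kx j : kx.2 \in V kx.1 -> (rk kx.1 < rk j)%N -> sg kx 0 j = 0.
  case/cP=> c0 _ _ kj; rewrite !mxE c0 1?ltnW // eqxx /=.
  by case: eqP => [jk|_]; [rewrite jk ltnn in kj | rewrite mulr0 subr0].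
pose rk1 (i : 'I_#|T|) := rk (enum_val i).1.
(* Any syzygy is reduced to zero by removing its last coordinate, which lies
   in the corresponding colon ideal. *)
have spanB N (v : 'rV[S]_m) : (forall j, (N <= rk j)%N -> v 0 j = 0) -> v *m A = 0 ->
    span_before B rk1 N v.
  elim: N v => [|N IHN] v v0 vA.
    by have -> : v = 0 by [apply/rowP=> j; rewrite v0 // mxE]; apply: span0.
  have [/existsP[k /eqP rkN]|noN] := boolP [exists k, rk k == N]; last first.
    apply: (@span_before_mono _ _ _ rk1 _ N) => [i /ltnW//|].
    apply: IHN => // j; rewrite leq_eqVlt => /orP[/eqP Nj|/v0//].
    by case/existsP: noN; exists j; rewrite -Nj.
  have [|q vk] := @var_ideal_sum K n (V k) (v 0 k).
    apply/lr_colon; exists (v 0 k *: delta_mx 0 k - v).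
      move=> j kj; rewrite !mxE eqxx /=; case: eqP => [->|/eqP jk].
        by rewrite mulr1 subrr.
      rewrite (v0 j) ?subr0 ?mulr0 //.
      rewrite -rkN ltn_neqAle kj andbT; apply: contraNneq jk => e.
      by apply/eqP; apply: (@lr_rank_inj r M).
    by rewrite mulmxBl vA subr0 -scalemxAl -rowE.
  pose s := \sum_(x in V k) q x *: sg (k, x).
  rewrite -(subrK s v); apply: spanD.
    apply: (@span_before_mono _ _ _ rk1 _ N) => [i /ltnW//|].
    apply: IHN => [j|]; last first.
      rewrite mulmxBl vA sub0r mulmx_suml big1 ?oppr0 // => x xV.
      by rewrite -scalemxAl sgA ?scaler0.
    rewrite leq_eqVlt => /orP[/eqP Nj|Nj].
      have -> : j = k by apply: (@lr_rank_inj r M); rewrite -Nj.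
      rewrite mxE [v 0 k]vk mxE summxE; apply/eqP; rewrite subr_eq0.
      by apply/eqP/eq_bigr => x xV; rewrite mxE sg_lead.
    rewrite mxE v0 // mxE summxE big1 ?subr0 // => x xV.
    by rewrite mxE sg_gt ?mulr0 //= rkN.
  apply: span_sum => x xV; apply: spanZ.
  have kxT : (k, x) \in T by rewrite inE.
  rewrite -(enum_rankK_in kxT kxT) -rowB; apply: span_row.
  by rewrite /rk1 enum_rankK_in ?rkN.
have BA : B *m A = 0.
  by apply/row_matrixP=> i; rewrite row_mul rowB sgA // row0.
(* The relations are ordered lexicographically: by their last coordinate, then
   by the variable found there. *)
pose rk2 (i : 'I_#|T|) := (rk1 i * n + (enum_val i).2)%N.
have rk2_lt i j : (rk2 i < rk2 j)%N = (rk1 i < rk1 j)%N ||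
    (rk1 i == rk1 j) && ((enum_val i).2 < (enum_val j).2)%N.
  rewrite /rk2; have := ltn_ord (enum_val i).2; have := ltn_ord (enum_val j).2.
  case: (ltngtP (rk1 i) (rk1 j)) => [lt_ij|lt_ji|->] /=; nia.
have rk1_eq i j : rk1 i = rk1 j -> (enum_val i).1 = (enum_val j).1.
  exact: (@lr_rank_inj r M).
have rk2_inj : injective rk2.
  move=> i j e; have := rk2_lt i j; have := rk2_lt j i; rewrite e ltnn.
  case: (ltngtP (rk1 i) (rk1 j)) => //= /rk1_eq e1.
  case: (ltngtP (enum_val i).2) => //= /val_inj e2 _ _; apply: enum_val_inj.
  by case: (enum_val i) (enum_val j) e1 e2 => [k x] [k' x'] /= -> ->.
(* For two relations with the same last coordinate, the colon ideal of distinct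
   variables appears; the relations with a smaller last coordinate span all syzygies
   supported there, so they absorb every remaining correction. *)
pose W (i : 'I_#|T|) := [set y in V (enum_val i).1 | (y < (enum_val i).2)%N].
have colonB i p : span_before B rk2 (rk2 i) (p *: row i B) <-> var_ideal (W i) p.
  split=> [[d d0 dE]|/var_ideal_sum[q ->]].
    have : var_ideal (W i) (p * 'X_((enum_val i).2)).
      have /rowP/(_ (enum_val i).1) := dE; rewrite rowB mxE sg_lead // mxE => ->.
      apply: gen_ideal_sum => j _ _.
      have [/d0->|] := leqP (rk2 i) (rk2 j); first by rewrite mul0r;
        apply: gen_ideal0.
      rewrite rk2_lt mxE => /orP[lt_ji|/andP[/eqP/rk1_eq e1 lt_ji]].
        by rewrite sg_gt // mulr0; apply: gen_ideal0.
      rewrite -e1 sg_lead //; apply: gen_idealM; apply: gen_ideal_gen.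
      by exists (enum_val j).2; rewrite // inE lt_ji -e1 TP.
    by apply: var_ideal_cancel; rewrite inE ltnn andbF.
  rewrite scaler_suml; apply: span_sum => y.
  rewrite inE => /andP[yV yx]; rewrite -scalerA; apply: spanZ; rewrite rowB.
  set kx := enum_val i in yV yx *; pose ky := (kx.1, y).
  have kyT : ky \in T by rewrite inE.
  rewrite -(subrK ('X_(kx.2) *: sg ky) ('X_y *: _)); apply: spanD; last first.
    apply: spanZ; rewrite -(enum_rankK_in kyT kyT) -rowB; apply: span_row.
    by rewrite rk2_lt /rk1 enum_rankK_in //= eqxx yx orbT.
  apply: (@span_before_mono _ _ _ rk1 _ (rk1 i)) => [j lt_ji|].
    by rewrite rk2_lt lt_ji.
  apply: spanB => [j|]; last first.
    by rewrite mulmxBl -!scalemxAl !sgA ?inE ?TP // !scaler0 subrr.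
  rewrite leq_eqVlt => /orP[/eqP/(@lr_rank_inj r M) <-|lt_ij]; rewrite !mxE.
    have := sg_lead kx (TP i); have := sg_lead ky yV; rewrite !mxE => -> ->.
    by rewrite mulrC subrr.
  have := sg_gt kx j (TP i) lt_ij; have := sg_gt ky j yV lt_ij.
  by rewrite !mxE => -> ->; rewrite !mulr0 subrr.
have homB i j : homogeneous_of_degree (B i j) 1.
  rewrite !mxE; apply: homogD; last by apply: homogN; have [] := cP _ (TP i).
  rewrite eqxx /=; case: eqP => _; rewrite ?mulr1 ?mulr0; first exact: homogXU.
  exact: homog0.
exists (LinearRows rk2_inj homB colonB); split=> // v; split=> [vA|[w ->]].
  have v0 j : ((\max_i rk i).+1 <= rk j)%N -> v 0 j = 0.
    by rewrite ltnNge (leq_bigmax (F := fun i => rk i) j).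
  by have [w w0 vE] := spanB _ _ v0 vA; exists w.
by rewrite -mulmxA BA mulmx0.
Qed.

Definition syz : linear_rows m :=
  proj1_sig (constructive_indefinite_description _ linear_rows_syzygies).

Lemma syz_deg : lr_deg syz = 1.
Proof. by have [] :=
  proj2_sig (constructive_indefinite_description _ linear_rows_syzygies). Qed.

Lemma syzP (v : 'rV[S]_m) : v *m A = 0 <-> exists w, v = w *m lr_mx syz.
Proof. by have [_] :=
  proj2_sig (constructive_indefinite_description _ linear_rows_syzygies). Qed.

End Syzygies.

Section Resolution.
Variables (L : S -> Prop) (M : linear_rows 1).

(** The iterated syzygies.  The number of columns is packed with the matrix so
    that at each step it reduces to the number of rows of the previous step. *)
Fixpoint tower i : {r & linear_rows r} :=
  if i is i'.+1 then
    existT linear_rows (lr_num (projT2 (tower i'))) (syz (projT2 (tower i')))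
  else existT linear_rows 1%N M.

Lemma tower_homog i r c :
  homogeneous_of_degree (lr_mx (projT2 (tower i.+1)) r c)
    ((lr_deg M + i.+1%:Z) - (lr_deg M + i%:Z)).
Proof.
have -> : (lr_deg M + i.+1%:Z) - (lr_deg M + i%:Z) = 1 by lia.
by rewrite -(syz_deg (projT2 (tower i))); apply: lr_homog.
Qed.

(** All maps being linear, the i-th free module is generated in one degree, and
    its other graded parts are zero even before homology is taken. *)
Lemma linear_rows_resolution :
  (forall p, L p <-> exists v : 'rV_(lr_num M), p = (v *m lr_mx M) 0 0) ->
  has_linear_resolution L.
Proof.
move=> LM.
have deg0 r : homogeneous_of_degree (lr_mx M r 0) (lr_deg M + 0%:Z).
  by rewrite addr0; apply: lr_homog.
pose F := @GradedFreeResolution K n L (fun i => lr_num (projT2 (tower i)))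
  (fun i _ => lr_deg M + i%:Z) (lr_mx M)
  (fun i => lr_mx (projT2 (tower i.+1))) deg0 tower_homog LM
  (@syzP 1 M) (fun i => @syzP _ (projT2 (tower i.+1))).
exists F, (lr_deg M) => i j ne_j v vj _; exists 0; rewrite mul0mx.
apply/rowP=> r; rewrite mxE; apply: contra_not_eq ne_j => /vj <-.
by rewrite /= addrC.
Qed.

End Resolution.

Lemma linear_quotients_resolution (L : S -> Prop) d (s : seq 'X_{1..n}) :
  monomial_ideal L -> generated_in_degree d L -> linear_quotients_wrt L s ->
  has_linear_resolution L.
Proof.
move=> mL dL [us sL sV].
pose A : 'cV[S]_(size s) := \col_i 'X_[nth 0%MM s i].
have spanA N (g : 'rV[S]_1) : span_before A (@nat_of_ord _) N g <->
    monomials_ideal (fun u => u \in take N s) (g 0 0).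
  split=> [[c c0 ->]|[t [ts gE]]].
    rewrite mxE; apply: gen_ideal_sum => j _ _; rewrite mxE.
    have [Nj|jN] := leqP N j; first by rewrite c0 // mul0r; apply: gen_ideal0.
    apply: gen_idealM; apply: gen_ideal_gen; exists (nth 0%MM s j) => //.
    rewrite -(nth_take _ jN) mem_nth // size_take_min.
    by rewrite leq_min jN ltn_ord.
  have -> : g = \sum_(x <- t) x.1 *: const_mx x.2.
    apply/rowP=> j; rewrite ord1 gE summxE; apply: eq_bigr => x _.
    by rewrite !mxE.
  rewrite big_seq; apply: span_sum => x /ts[u us' ->]; apply: spanZ.
  have uN : (index u s < size s)%N by rewrite index_mem (mem_take us').
  have -> : const_mx 'X_[u] = row (Ordinal uN) A.
    by apply/rowP=> j; rewrite !mxE /= nth_index // (mem_take us').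
  by apply: span_row; rewrite /= index_ltn.
(* For the first generator the colon ideal is that of the zero ideal, which is
   generated by no variable. *)
have colonA (k : 'I_(size s)) : exists V : {set 'I_n}, forall p,
    span_before A (@nat_of_ord _) k (p *: row k A) <-> var_ideal V p.
  have [k0|k0] := posnP k; last first.
    have [|V VP] := sV k; first by rewrite k0 ltn_ord.
    by exists V => p; rewrite spanA !mxE -VP.
  exists set0 => p; rewrite spanA !mxE k0 take0 monomials_idealP var_idealP.
  split=> p0 u => [up|/msuppMX_mem[v vp _]].
    have [|//] := p0 (u + nth 0%MM s k)%MM.
    by rewrite -k0; apply/msuppMX_mem; exists u.
  by have [i] := p0 v vp; rewrite inE.
have /fin_all_exists[V VP] := colonA.
have homA i j : homogeneous_of_degree (A i j) d%:Z.
  have sdeg : mdeg (nth 0%MM s i) = d by apply/dL/sL/mem_nth.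
  by rewrite mxE -sdeg; apply: homogX.
apply: (@linear_rows_resolution L (LinearRows (@ord_inj _) homA VP)) => p /=.
have LE : L p <-> span_before A (@nat_of_ord _) (size s) (const_mx p).
  rewrite spanA take_size mxE monomials_idealP (monomial_ideal_supp p mL).
  split=> Lp u /Lp; first by move=> /exists_min_gen[v mv vu]; exists v;
    first exact/sL.
  by case=> v /sL[Lv _]; apply: monomial_ideal_up.
rewrite LE; split=> [[v _ /rowP/(_ 0)]|[v pE]]; first by rewrite mxE => ->; exists v.
exists v => [j|]; first by rewrite leqNgt ltn_ord.
by apply/rowP=> j; rewrite ord1 mxE.
Qed.

End LinearQuotients.

(** * What a linear resolution says about generators and first syzygies *)

Section LinearResolution.
Variables (K : fieldType) (n : nat).
Local Notation S := {mpoly K[n]}.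
Variables (L : S -> Prop) (F : graded_free_resolution L).
Hypothesis mL : monomial_ideal L.
Implicit Types (u v : 'X_{1..n}) (p q : S).

Local Notation const0 := (map_mx (mcoeff (0%MM : 'X_{1..n}) : S -> K)).
Local Notation const := (map_mx (@mpolyC n K)).

Lemma const0K m r (A : 'M[K]_(m, r)) : const0 (const A) = A.
Proof. by apply/matrixP=> i j; rewrite !mxE mpolyCK. Qed.

Lemma aug_in r : L (res_aug F r 0).
Proof. by apply/res_aug_onto; exists (delta_mx 0 r); rewrite -rowE mxE. Qed.

Lemma mulmx_aug_msupp (v : 'rV[S]_(res_rank F 0)) u :
  ((v *m res_aug F) 0 0)@_u != 0 ->
  exists r a b, [/\ a \in msupp (v 0 r), b \in msupp (res_aug F r 0),
                    L 'X_[b] & u = (a + b)%MM].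
Proof.
rewrite mxE -mcoeff_msupp => /msupp_sum_le/flatten_mapP[r _].
move=> /msuppM_le/allpairsP[[a b] /= [av br ->]]; exists r, a, b; split=> //.
exact: (monomial_ideal_supp _ mL).1 (aug_in r) b br.
Qed.

(** If the degree of a minimal generator u were wrong, Tor_0 would vanish there,
    so u could be written with coefficients without constant term; but then u
    would be a proper multiple of another monomial of L. *)
Lemma Tor0_min_gen (d : int) u :
    (forall j, j <> d -> Tor_vanishes F 0 j) ->
  min_gen L u -> (mdeg u)%:Z = d.
Proof.
move=> tor0 [Lu minu]; apply: NNPP => /tor0 Tu.
have [v vE] := (res_aug_onto F 'X_[u]).1 Lu.
pose c := \row_r if res_deg r == (mdeg u)%:Z then (v 0 r)@_0%MM else 0.
have [||w cE] := Tu c => //.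
  by move=> r; rewrite mxE; case: ifP => [/eqP//|_]; rewrite eqxx.
(* Subtracting a boundary removes the constant terms of v in the degree of u. *)
pose v' := v - const w *m res_diff F 0.
have v'E : 'X_[u] = (v' *m res_aug F) 0 0.
  rewrite mulmxBl vE [_ *m _ *m _](res_exact0 _).2 ?subr0 //.
  by exists (const w).
have : ((v' *m res_aug F) 0 0)@_u != 0 by rewrite -v'E mcoeffX eqxx oner_eq0.
case/mulmx_aug_msupp=> r [a [b [av br Lb uE]]].
have bu : b = u by apply: minu; rewrite // uE lem_addl.
have a0 : a = 0%MM by apply: (@addIm _ b); rewrite add0m -uE bu.
move: av; rewrite a0 mcoeff_msupp !mxE.
have -> : \sum_j (const w) 0 j * res_diff F 0 j r =
          (const w *m res_diff F 0) 0 r by rewrite mxE.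
have := congr1 (fun A : 'rV_ _ => A 0 r) (map_mxM (mcoeff 0%MM) (const w) (res_diff
  F 0)).
rewrite mxE const0K mcoeffB => -> /=.
have -> : (w *m const0 (res_diff F 0)) 0 r = c 0 r by rewrite cE.
by rewrite mxE -(res_aug_homog br) bu eqxx subrr eqxx.
Qed.

Lemma homogeneous_lift u : L 'X_[u] ->
  exists2 a : 'rV[S]_(res_rank F 0), 'X_[u] = (a *m res_aug F) 0 0 &
    forall r, homogeneous_of_degree (a 0 r) ((mdeg u)%:Z - res_deg r).
Proof.
case/(res_aug_onto F)=> v vE.
exists (\row_r hcomp ((mdeg u)%:Z - res_deg r) (v 0 r)).
  rewrite -(hcomp_mulmx _ _ (fun r => @res_aug_homog _ _ _ F r)) -vE.
  by rewrite (hcomp_of_homog _ (@homogX K n u)) eqxx.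
by move=> r; rewrite mxE; apply: hcomp_homog.
Qed.

Lemma homogeneous_syzygy (z : 'rV[S]_(res_rank F 0)) (e : int) :
    z *m res_aug F = 0 ->
    (forall r, homogeneous_of_degree (z 0 r) (e - res_deg r)) ->
  exists2 w : 'rV[S]_(res_rank F 1), z = w *m res_diff F 0 &
    forall s, homogeneous_of_degree (w 0 s) (e - res_deg s).
Proof.
move=> /(res_exact0 (g := F) z).1[w zE] hz.
exists (\row_s hcomp (e - res_deg s) (w 0 s)); last first.
  by move=> s; rewrite mxE; apply: hcomp_homog.
apply/rowP=> r; have := hcomp_of_homog (e - res_deg r) (hz r).
rewrite eqxx => <-; rewrite zE.
rewrite (hcomp_mulmx _ _ (fun s => @res_diff_homog _ _ _ F 0 s r)).
congr ((_ *m _) 0 r); apply/rowP=> s; rewrite !mxE; congr (hcomp _ _).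
by rewrite opprB addrA subrK.
Qed.

Lemma const0_eq0_sum m (w : 'rV[S]_m) : const0 w = 0 ->
  exists Q : 'I_n -> 'rV[S]_m, w = \sum_x 'X_x *: Q x.
Proof.
move=> w0; suff /fin_all_exists[q qE] : forall s, exists q : 'I_n -> S,
    w 0 s = \sum_x q x * 'X_x.
  exists (fun x => \row_s q s x); apply/rowP=> s; rewrite qE summxE.
  by apply: eq_bigr => x _; rewrite !mxE mulrC.
move=> s; have [|q ->] := @var_ideal_sum K n setT (w 0 s).
  apply/var_idealP=> u uw; have /existsP[x ux] : [exists x, u x != 0%N].
    apply: contraT; rewrite negb_exists => /forallP u0.
    have u0E : u = 0%MM.
      by apply/mnmP=> x; rewrite mnm0E; apply/eqP; rewrite -[_ == _]negbK.
    have /rowP/(_ s) := w0; rewrite !mxE; move: uw.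
    by rewrite u0E mcoeff_msupp => /eqP.
  by exists x; rewrite ?inE ?lt0n.
by exists q; apply: eq_bigl => x; rewrite inE.
Qed.

(** As Tor_1 vanishes in degree 4, the relation z between the two squares is a
    sum of terms x z_x, with x a variable and z_x a syzygy.  Comparing the terms
    with x_l, the vector f = x_l a - z_l is found to have coordinates in the
    prime ideal of the other variables, although it maps to x_l x_i^2.  Hence
    x_l x_i^2 is divisible by x_q w with q different from l and w in L; this
    forces q = i, and then w divides x_i x_l. *)
Lemma Tor1_squares (i l : 'I_n) :
    Tor_vanishes F 1 4%:Z -> i != l ->
    L 'X_[U_(i) + U_(i)] -> L 'X_[U_(l) + U_(l)] ->
  L 'X_[U_(i) + U_(l)].
Proof.
move=> tor1 il /homogeneous_lift[a aE ha] /homogeneous_lift[b bE hb].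
have deg2 j : mdeg (U_(j) + U_(j) : 'X_{1..n})%MM = 2%N by rewrite mdegD mdeg1.
have hX2 j : homogeneous_of_degree ('X_[U_(j) + U_(j)] : S) 2%:Z.
  by rewrite -(deg2 j); apply: homogX.
pose z := 'X_[U_(l) + U_(l)] *: a - 'X_[U_(i) + U_(i)] *: b.
have zaug : z *m res_aug F = 0.
  apply/rowP=> j; rewrite ord1 mulmxBl -!scalemxAl.
  move: (a *m _) (b *m _) aE bE => A B aE bE.
  by rewrite !mxE -aE -bE mulrC subrr.
have hz r : homogeneous_of_degree (z 0 r) (4%:Z - res_deg r).
  have -> : 4%:Z - res_deg r = 2%:Z + (2%:Z - res_deg r) by lia.
  rewrite !mxE; apply: homogD; last apply: homogN; apply: homogM => //.
    by have := ha r; rewrite deg2.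
  by have := hb r; rewrite deg2.
have [w zE hw] := homogeneous_syzygy zaug hz.
have [||y wy] := tor1 (const0 w).
- move=> s; rewrite mxE -mcoeff_msupp => /hw; rewrite mdeg0; lia.
- change (const0 w *m const0 (res_diff F 0) = 0).
  rewrite -map_mxM -zE; apply/rowP=> r; rewrite !mxE.
  rewrite rmorphB !rmorphM /= !mcoeffX !mnmD_eq0 !mnm1_eq0 /=.
  by rewrite !mul0r subrr.
(* The constant terms of w form a cycle, hence a boundary, which is removed. *)
pose w' := w - const y *m res_diff F 1.
have w'E : z = w' *m res_diff F 0.
  rewrite mulmxBl -zE [_ *m _ *m _](res_exact _).2 ?subr0 //.
  by exists (const y).
have [|Q QE] := @const0_eq0_sum _ w'.
  by rewrite map_mxB map_mxM const0K {1}wy subrr.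
pose zq x := Q x *m res_diff F 0.
have zqE : z = \sum_x 'X_x *: zq x.
  by rewrite w'E QE mulmx_suml; apply: eq_bigr => x _; rewrite -scalemxAl.
pose f := 'X_l *: a - zq l.
have Xf : 'X_l *: f = \sum_(x | x != l) 'X_x *: zq x + 'X_[U_(i) + U_(i)] *: b.
  rewrite scalerBr scalerA -mpolyXD -[LHS]addr0.
  have := zqE; rewrite (bigD1 l) //= => /eqP.
  rewrite /z subr_eq => /eqP ->.
  by rewrite addr0 [_ + _ - _]addrC !addrA [- _ + _]addrC subrr add0r.
have fV r : var_ideal (~: [set l]) (f 0 r).
  apply: (@var_ideal_cancel _ _ _ _ l); first by rewrite !inE eqxx.
  have /rowP/(_ r) := Xf; rewrite mxE mulrC => ->; rewrite mxE.
  apply: gen_idealD.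
    rewrite summxE; apply: gen_ideal_sum => x _ xl; rewrite mxE mulrC.
    by apply: gen_idealM; apply: gen_ideal_gen; exists x; rewrite ?inE.
  rewrite mxE mpolyXD mulrC mulrA; apply: gen_idealM; apply: gen_ideal_gen.
  by exists i; rewrite ?inE.
have faug : (f *m res_aug F) 0 0 = 'X_[U_(l) + (U_(i) + U_(i))].
  rewrite mulmxBl [zq l *m _](res_exact0 _).2 ?subr0; last by exists (Q l).
  by rewrite -scalemxAl mxE -aE -mpolyXD.
have : ((f *m res_aug F) 0 0)@_(U_(l) + (U_(i) + U_(i))) != 0.
  by rewrite faug mcoeffX eqxx oner_eq0.
case/mulmx_aug_msupp=> r [m1 [m2 [/((var_idealP _ _).1 (fV r))[x]]]].
rewrite !inE => xl m1x _ Lm2 uE.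
apply: (monomial_ideal_up mL Lm2); apply/mnm_lepP=> j.
have /mnmP uEj := uE; have := uEj j; have := uEj x; rewrite !mnmDE !mnm1E.
rewrite [l == x]eq_sym (negPf xl) /=; case: (i =P x) => [ix|_] /=; last by lia.
by rewrite -{}ix in m1x *; case: (i =P j) => [<-|_] /=; lia.
Qed.

End LinearResolution.

(** * Polymatroidal ideals have reverse lexicographic linear quotients *)

Lemma finite_decidable (T : finType) (P : T -> Prop) :
  exists p : pred T, forall x, p x <-> P x.
Proof.
suff /fin_all_exists[p pP] : forall x, exists b : bool, b <-> P x by exists p.
by move=> x; have [Px|nPx] := classic (P x); [exists true | exists false].
Qed.

Section RevLex.
Variable n : nat.
Implicit Types (u v w : 'X_{1..n}).

Lemma revlex_gt_irr : irreflexive (@revlex_gt n).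
Proof.
move=> u; rewrite /revlex_gt ltnn eqxx /=; apply/existsP=> -[i].
by rewrite ltnn.
Qed.

Lemma revlex_gtP u v : mdeg u = mdeg v ->
  reflect (exists i : 'I_n, (u i < v i)%N /\
             forall j : 'I_n, (i < j)%N -> u j = v j)
          (revlex_gt u v).
Proof.
move=> uv; rewrite /revlex_gt uv ltnn eqxx /=.
apply: (iffP existsP) => -[i].
  by case/andP=> lt_uv /forallP eq_uv; exists i; split=> // j ij;
    apply/eqP/(implyP (eq_uv j)).
by case=> lt_uv eq_uv; exists i; rewrite lt_uv; apply/forallP=> j;
  apply/implyP=> /eq_uv->.
Qed.

Lemma revlex_gt_mdeg u v : revlex_gt u v -> (mdeg v <= mdeg u)%N.
Proof. by case/orP=> [/ltnW|/andP[/eqP->]]. Qed.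

Lemma revlex_gt_trans : transitive (@revlex_gt n).
Proof.
move=> v u w uv vw; have duv := revlex_gt_mdeg uv; have dvw := revlex_gt_mdeg vw.
have [lt_wu|le_uw] := ltnP (mdeg w) (mdeg u); first by rewrite /revlex_gt lt_wu.
have e1 : mdeg u = mdeg v by lia.
have e2 : mdeg v = mdeg w by lia.
case/(revlex_gtP e1): uv => i [ui eqi]; case/(revlex_gtP e2): vw => j [vj eqj].
apply/(revlex_gtP (etrans e1 e2)).
have [ij|ji|/val_inj ij] := ltngtP i j.
- by exists j; rewrite (eqi j ij); split=> // k jk;
  rewrite eqi ?eqj // (ltn_trans ij).
- by exists i; rewrite -(eqj i ji); split=> // k ik;
  rewrite eqi ?eqj // (ltn_trans ji).
rewrite -{}ij in vj eqj; exists i; split; first exact: ltn_trans vj.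
by move=> k ik; rewrite eqi ?eqj.
Qed.

Lemma revlex_gt_total u v : mdeg u = mdeg v -> u != v ->
  revlex_gt u v || revlex_gt v u.
Proof.
move=> uv ne_uv; have /existsP[i0 ui0] : [exists i, u i != v i].
  apply: contraNT ne_uv; rewrite negb_exists => /forallP eq_uv.
  by apply/eqP/mnmP=> i; apply/eqP; rewrite -[_ == _]negbK.
case: (@arg_maxnP _ i0 (fun i => u i != v i) (@nat_of_ord n) ui0) => i ui max_i.
have eq_uv (j : 'I_n) : (i < j)%N -> u j = v j.
  by move=> ij; apply/eqP; apply: contraTT ij => /max_i; rewrite -leqNgt.
have [lt_i|lt_i|/eqP] := ltngtP (u i) (v i); last by rewrite (negPf ui).
  by apply/orP; left; apply/revlex_gtP=> //; exists i.
by apply/orP; right; apply/revlex_gtP=> //; exists i; split=> // j /eq_uv.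
Qed.

Lemma exists_revlex_sorted (P : 'X_{1..n} -> Prop) d :
  (forall u, P u -> mdeg u = d) ->
  exists s, [/\ sorted (@revlex_gt n) s, uniq s & forall u, u \in s <-> P u].
Proof.
move=> dP; have [p pP] :=
  @finite_decidable 'X_{1..n < d.+1} (fun u : 'X_{1..n < d.+1} => P (bmnm u)).
pose t := [seq bmnm w | w : 'X_{1..n < d.+1} in p].
have tP u : u \in t <-> P u.
  split=> [/imageP[v vp ->]|Pu]; first exact/pP.
  have du : (mdeg u < d.+1)%N by rewrite (dP u Pu).
  by apply/imageP; exists (BMultinom du) => //; apply/pP.
have ut : uniq t by rewrite map_inj_uniq ?enum_uniq //; apply: val_inj.
pose ge u v := (u == v) || revlex_gt u v.
have ge_total : {in t &, total ge}.
  move=> u v /tP/dP du /tP/dP dv; rewrite /ge.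
  have [//|ne_uv] := eqVneq u v.
  by rewrite /= revlex_gt_total // du dv.
exists (sort ge t); split; last 1 first.
- by move=> u; rewrite mem_sort; apply: tP.
- have := sort_sorted_in ge_total (allss t).
  have : uniq (sort ge t) by rewrite sort_uniq.
  case: (sort ge t) => //= x s; elim: s x => //= y s IHs x.
  rewrite inE negb_or => /andP[/andP[/negPf xy xs] uys] /andP[]; rewrite /ge xy /=.
  by move=> -> /= /IHs; apply; move: uys; case/andP=> -> ->.
by rewrite sort_uniq.
Qed.

End RevLex.

Section Polymatroidal.
Variables (K : fieldType) (n : nat) (L : {mpoly K[n]} -> Prop).
Hypothesis polyL : polymatroidal L.
Implicit Types (u v w : 'X_{1..n}).

(** Exchanging u against an earlier v at the last place where they differ
    raises u in the order, and only multiplies it by one variable. *)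
Lemma exchange_revlex u v : min_gen L u -> min_gen L v -> revlex_gt v u ->
  exists2 j : 'I_n, (u j < v j)%N &
    exists2 w, min_gen L w & revlex_gt w u /\ (w <= u + U_(j))%MM.
Proof.
case: polyL => _ [d dL] exch mu mv.
have duv : mdeg v = mdeg u by rewrite !dL.
case/(revlex_gtP duv)=> i [vi_lt eq_vu].
have [j uj_lt Lw] := exch u v mu mv i vi_lt.
have ij : (i == j) = false by apply/negP=> /eqP ij; rewrite ij in vi_lt; lia.
have Ui : (U_(i) <= u)%MM by rewrite lep1mP; lia.
have dw : mdeg (u - U_(i) + U_(j))%MM = mdeg u.
  by rewrite -[in RHS](submK Ui) !mdegD !mdeg1.
exists j => //; exists (u - U_(i) + U_(j))%MM.
  exact: min_gen_degree dL Lw (etrans dw (dL _ mu)).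
split; last first.
  by apply/mnm_lepP=> k; rewrite !mnmDE mnmBE; lia.
apply/revlex_gtP=> //; exists i; split=> [|k ik].
  by rewrite mnmDE mnmBE !mnm1E eqxx eq_sym ij; lia.
have jk : (j == k) = false by apply/negP=> /eqP jk; have := eq_vu k ik;
  rewrite -jk; lia.
by rewrite mnmDE mnmBE !mnm1E jk -val_eqE ltn_eqF // subn0 addn0.
Qed.

(** The exchange shows that each generator of the colon ideal is divisible by a
    variable which is already in it. *)
Lemma polymatroidal_revlex : revlex_linear_quotients L.
Proof.
case: (polyL) => mL [d dL] _; split=> //.
have [s [sorted_s us sP]] := exists_revlex_sorted dL.
exists s => //; split=> // i /andP[_ lt_is].
set u := nth 0%MM s i; have mu : min_gen L u by apply/sP/mem_nth.
have takeP v : v \in take i s <-> min_gen L v /\ revlex_gt v u.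
  split=> [vt|[/sP vs]].
    split; first exact/sP/(mem_take vt).
    have lt_vi := index_ltn vt.
    rewrite -(nth_index 0%MM (mem_take vt)).
    apply: (sorted_ltn_nth (@revlex_gt_trans n)) => //.
    by rewrite inE index_mem (mem_take vt).
  have vsz : (index v s < size s)%N by rewrite index_mem.
  rewrite in_take //; have [//|lt_iv|ei] := ltngtP (index v s) i; last first.
    by rewrite /u -ei nth_index // revlex_gt_irr.
  have := sorted_ltn_nth (@revlex_gt_trans n) 0%MM sorted_s _ _ lt_is vsz lt_iv.
  rewrite nth_index // -/u => uv vu.
  by have := revlex_gt_trans uv vu; rewrite revlex_gt_irr.
have [V VP] := @finite_decidable 'I_n (fun j =>
  exists2 w, w \in take i s & (w <= u + U_(j))%MM).
exists [set j in V] => p; rewrite /ideal_colon monomials_idealP var_idealP.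
split=> [Ip m mp|Vp m /msuppMX_mem[m' m'p ->]].
  have [|v /takeP[mv vu] le_v] := Ip (m + u)%MM; first by apply/msuppMX_mem; exists m.
  have [j uj [w mw [wu le_w]]] := exchange_revlex mu mv vu.
  exists j; last by have /mnm_lepP/(_ j) := le_v; rewrite mnmDE; lia.
  by rewrite inE; apply/VP; exists w => //; apply/takeP.
have [j] := Vp m' m'p; rewrite inE => /VP[w wt le_w] m'j.
exists w => //; apply: lepm_trans le_w _; apply/mnm_lepP=> k.
by rewrite !mnmDE mnm1E addnC leq_add2r; case: eqP => // <-.
Qed.

End Polymatroidal.

(** * Quadratic monomial ideals as graphs with loops *)

Section Quadratic.
Variables (K : fieldType) (n : nat).
Local Notation S := {mpoly K[n]}.
Implicit Types (I J L : S -> Prop) (u v w : 'X_{1..n}) (p q : S).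
Implicit Types (i j l : 'I_n) (C : {set 'I_n}).

Definition edge I i j := I 'X_[U_(i) + U_(j)].

(** The edge l h expresses that l is not isolated.  Loops are included:
    for i = j, the condition joins i to every non-isolated vertex. *)
Definition edge_join I :=
  forall i j l h, edge I i j -> edge I l h -> edge I i l \/ edge I j l.

Lemma edgeC I i j : edge I i j -> edge I j i.
Proof. by rewrite /edge addmC. Qed.

Lemma same_ideal_min_gen I J u : same_ideal I J -> min_gen I u -> min_gen J u.
Proof.
by move=> IJ [Iu minu]; split=> [|v /IJ Iv vu]; [apply/IJ | apply: minu].
Qed.

Lemma same_ideal_sym I J : same_ideal I J -> same_ideal J I.
Proof. by move=> IJ p; split=> /IJ. Qed.

Lemma same_ideal_polymatroidal I J :
  same_ideal I J -> polymatroidal I -> polymatroidal J.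
Proof.
move=> IJ [[A IA] [d dI] exch]; have JI := same_ideal_sym IJ; split.
- by exists A => p; split=> [/JI/IA|/IA/IJ].
- by exists d => u /(same_ideal_min_gen JI)/dI.
move=> u v /(same_ideal_min_gen JI) mu /(same_ideal_min_gen JI) mv i /(exch u v mu
  mv).
by case=> j uj /IJ; exists j.
Qed.

Section DegreeTwo.
Variable I : S -> Prop.
Hypotheses (mI : monomial_ideal I) (I2 : generated_in_degree 2 I).

Lemma quadraticX u :
  I 'X_[u] <-> exists i j, edge I i j /\ (U_(i) + U_(j) <= u)%MM.
Proof.
split=> [/exists_min_gen[v mv vu]|[i [j [Eij le_u]]]].
  have [i [j vE]] := mdeg2P (I2 mv); exists i, j; rewrite /edge -vE; split=> //.
  by case: mv.
exact: monomial_ideal_up mI Eij le_u.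
Qed.

Lemma edge_min_gen i j : edge I i j -> min_gen I (U_(i) + U_(j))%MM.
Proof. by move=> Eij; apply: (min_gen_degree I2 Eij); rewrite mdegD !mdeg1. Qed.

(** Exchanging h, in the edge l h, against an end of the edge i j. *)
Lemma polymatroidal_edge_join : polymatroidal I -> edge_join I.
Proof.
case=> _ _ exch i j l h Eij Elh.
have [li|li] := eqVneq l i; first (by rewrite li; right; apply: edgeC).
have [lj|lj] := eqVneq l j; first (by rewrite lj; left).
have [hi|hi] := eqVneq h i; first (by rewrite -hi; left; apply: edgeC).
have [hj|hj] := eqVneq h j; first (by rewrite -hj; right; apply: edgeC).
have [|q] := exch _ _ (edge_min_gen Elh) (edge_min_gen Eij) h.
  by rewrite !mnmDE !mnm1E ![_ == h]eq_sym (negPf hi) (negPf hj) eqxx addn1.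
rewrite addmK !mnmDE !mnm1E => lt_q; rewrite addmC => Eql.
case: (i =P q) (j =P q) lt_q Eql => [<-|_] [<-|_] //= _; [left|left|right];
  exact.
Qed.

Lemma edge_exchange i j l h (v := (U_(l) + U_(h))%MM) (u := (U_(i) + U_(j))%MM) :
    edge_join I -> edge I i j -> edge I l h -> (v i < u i)%N ->
  exists2 q, (u q < v q)%N & I 'X_[u - U_(i) + U_(q)].
Proof.
move=> joinI Eij Elh; rewrite /u /v !mnmDE !mnm1E eqxx => lt_i.
suff [q lt_q Ejq] : exists2 q, ((i == q) + (j == q) < (l == q) + (h == q))%N & edge
  I j q.
  by exists q; rewrite ?mnmDE ?mnm1E // [(U_(i) + _)%MM]addmC addmK.
have [jl|jl] := eqVneq j l.
  exists h; last by rewrite jl.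
  by move: lt_i; rewrite -jl eqxx [i == h]eq_sym; case: (h == i); lia.
have [jh|jh] := eqVneq j h.
  exists l; last by rewrite jh; apply: edgeC.
  by move: lt_i; rewrite -jh eqxx [i == l]eq_sym; case: (l == i); lia.
have [/edgeC Ejl|/edgeC Ejh] := joinI l h j i Elh (edgeC Eij).
  exists l => //; rewrite eqxx (negPf jl) addn0.
  by case: (i =P l) lt_i => [->|_]; rewrite ?eqxx ?(negPf jl); lia.
exists h => //; rewrite eqxx (negPf jh) addn0.
by case: (i =P h) lt_i => [->|_]; rewrite ?eqxx ?(negPf jh); lia.
Qed.

Lemma edge_join_polymatroidal : edge_join I -> polymatroidal I.
Proof.
move=> joinI; split=> //; first by exists 2%N.
move=> u v mu mv i; have [a [b uE]] := mdeg2P (I2 mu).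
have [l [h vE]] := mdeg2P (I2 mv).
have Eab : edge I a b by rewrite /edge -uE; case: mu.
have Elh : edge I l h by rewrite /edge -vE; case: mv.
rewrite {}uE {}vE in mu mv * => lt_i.
have [ia|ia] := eqVneq i a; first by subst; apply: edge_exchange.
have [ib|ib] := eqVneq i b.
  by subst; rewrite [(U_(a) + _)%MM]addmC in lt_i *;
    apply/edge_exchange/lt_i => //; apply: edgeC.
by move: lt_i; rewrite !mnmDE !mnm1E ![_ == i]eq_sym (negPf ia) (negPf ib) addn0 ltn0.
Qed.

End DegreeTwo.

(** * Monomial localization *)

(** The exponent vector of the monomial after substituting 1 for the variables
    in C. *)
Definition restrict_away C u : 'X_{1..n} :=
  [multinom if i \in C then 0%N else u i | i < n].

Lemma gen_ideal_sub (G H : S -> Prop) p :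
  (forall q, G q -> gen_ideal H q) -> gen_ideal G p -> gen_ideal H p.
Proof.
by move=> GH [s [Gs ->]]; apply: gen_ideal_sum => t /Gs/GH Ht _; apply: gen_idealM.
Qed.

Lemma localizationE I C : monomial_ideal I ->
  same_ideal (localization I C)
    (monomials_ideal (fun u => exists2 w, I 'X_[w] & u = restrict_away C w)).
Proof.
move=> mI; set sub := [tuple (if i \in C then 1 else 'X_i : S) | i < n].
have subX w : 'X_[w] \mPo sub = 'X_[restrict_away C w].
  rewrite comp_mpolyX mpolyXE_id; apply: eq_bigr => i _.
  by rewrite tnth_mktuple mnmE; case: ifP; rewrite ?expr1n.
move=> p; split; apply: gen_ideal_sub => q.
  case=> p' Ip' ->; rewrite [p']mpolyE raddf_sum /=.
  apply: gen_ideal_sum => w wp' _; rewrite comp_mpolyZ subX -mul_mpolyC.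
  apply: gen_idealM; apply: gen_ideal_gen; exists (restrict_away C w) => //.
  by exists w => //; apply: (monomial_ideal_supp p' mI).1.
case=> _ [w Iw ->] ->; apply: gen_ideal_gen.
by exists 'X_[w] => //; rewrite subX.
Qed.

Lemma localization_monomial I C :
  monomial_ideal I -> monomial_ideal (localization I C).
Proof. by move=> mI; eexists; apply: localizationE. Qed.

Section LocalizeDegreeTwo.
Variable I : S -> Prop.
Hypotheses (mI : monomial_ideal I) (I2 : generated_in_degree 2 I).

Lemma localizationX C u : localization I C 'X_[u] <->
  exists i j, edge I i j /\
    forall h, h \notin C -> ((i == h) + (j == h) <= u h)%N.
Proof.
rewrite (localizationE C mI) monomials_idealX; split.
  case=> _ [w /(quadraticX mI I2)[i [j [Eij /mnm_lepP ijw]]] ->] /mnm_lepP wu.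
  exists i, j; split=> // h hC; move: (ijw h) (wu h).
  by rewrite mnmDE !mnm1E mnmE (negPf hC); apply: leq_trans.
case=> i [j [Eij le_u]]; exists (restrict_away C (U_(i) + U_(j)))%MM.
  by exists (U_(i) + U_(j))%MM.
apply/mnm_lepP=> h; rewrite mnmE; case: ifPn => // /le_u.
by rewrite mnmDE !mnm1E.
Qed.

Lemma degree0_polymatroidal L :
  monomial_ideal L -> L 'X_[0] -> polymatroidal L.
Proof.
move=> mL L0; have min0 u : min_gen L u -> u = 0%MM.
  by case=> _ /(_ _ L0) -> //; apply/mnm_lepP=> i; rewrite mnm0E.
split=> //; first by exists 0%N => u /min0->; rewrite mdeg0.
by move=> u v /min0-> _ i; rewrite mnm0E.
Qed.

Lemma degree1_polymatroidal L :
  monomial_ideal L -> generated_in_degree 1 L -> polymatroidal L.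
Proof.
move=> mL L1; split=> //; first by exists 1%N.
move=> u v mu mv i; have [a /eqP uE] := mdeg1P _ (introT eqP (L1 _ mu)).
have [b /eqP vE] := mdeg1P _ (introT eqP (L1 _ mv)).
case: mv => Lv _; rewrite {}uE {}vE !mnm1E in Lv * => lt_i.
have ai : a = i by apply/eqP; move: lt_i; case: (a == i).
rewrite ai eqxx in lt_i *; exists b.
  by rewrite !mnm1E eqxx eq_sym.
by rewrite -[X in (X - _)%MM]add0m addmK add0m.
Qed.

(** If the localized variables touch no edge, nothing changes; if they contain
    an edge, the unit ideal results; otherwise every edge has a vertex adjacent
    to one of them, and that vertex has become a generator. *)
Lemma edge_join_localization C :
  edge_join I -> polymatroidal (localization I C).
Proof.
move=> joinI; have mL := localization_monomial C mI.
have [L0|nL0] := classic (localization I C 'X_[0]);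
  first exact: degree0_polymatroidal.
have [[i [j [Eij [iC jC]]]]|noE] :=
  classic (exists i j, edge I i j /\ i \in C /\ j \notin C); last first.
  have noC i j : edge I i j -> i \notin C.
    move=> Eij; apply/negP=> iC; have [jC|jC] := boolP (j \in C).
      apply: nL0; apply/localizationX; exists i, j; split=> // h hC.
      by rewrite mnm0E; case: eqP hC => [<-|_]; rewrite ?iC //;
        case: eqP => [<-|//]; rewrite jC.
    by apply: noE; exists i, j.
  apply: same_ideal_polymatroidal (edge_join_polymatroidal mI I2 joinI).
  apply: same_monomial_ideal => // u; rewrite localizationX (quadraticX mI I2).
  split=> -[a [b [Eab le_u]]]; exists a, b; split=> //.
    by move/mnm_lepP: le_u => le_u h _; rewrite -!mnm1E -mnmDE.
  apply/mnm_lepP=> h; rewrite mnmDE !mnm1E; have [hC|/le_u//] := boolP (h \in C).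
  case: eqP => [ah|_]; first by have := noC _ _ Eab; rewrite ah hC.
  by case: eqP => [bh|_] //; have := noC _ _ (edgeC Eab); rewrite bh hC.
apply: degree1_polymatroidal => // u [Lu minu].
suff [a La /minu <-//] : exists2 a, localization I C 'X_a & (U_(a) <= u)%MM.
  by rewrite mdeg1.
have nbr a b : edge I a b -> b \in C -> localization I C 'X_a.
  move=> Eab bC; apply/localizationX; exists a, b; split=> // h hC.
  rewrite mnm1E; case: (b =P h) => [bh|_]; rewrite ?addn0 //.
  by rewrite -bh bC in hC.
have [a [b [Eab le_u]]] := (localizationX C u).1 Lu.
have le1 h : h \notin C -> (h == a) || (h == b) -> (U_(h) <= u)%MM.
  move=> hC hab; rewrite lep1mP -lt0n; have := le_u h hC.
  by case/orP: hab => /eqP->; rewrite eqxx; lia.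
have [aC|aC] := boolP (a \in C); have [bC|bC] := boolP (b \in C).
- case: nL0; apply/localizationX; exists a, b; split=> // h hC.
  by rewrite mnm0E; case: eqP hC => [<-|_]; rewrite ?aC //; case: eqP => [<-|//];
    rewrite bC.
- by exists b; [apply: nbr (edgeC Eab) aC | apply: le1; rewrite ?eqxx ?orbT].
- by exists a; [apply: nbr Eab bC | apply: le1; rewrite ?eqxx].
have [Eai|Ebi] := joinI a b i j Eab Eij.
  by exists a; [apply: nbr Eai iC | apply: le1; rewrite ?eqxx].
by exists b; [apply: nbr Ebi iC | apply: le1; rewrite ?eqxx ?orbT].
Qed.

(** Localizing at a non-loop vertex c turns its neighbours into generators, so
    a surviving edge must be redundant. *)
Lemma single_degree_edge c h a b :
    generated_in_single_degree (localization I [set c]) ->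
    ~ edge I c c -> edge I c h -> edge I a b -> a != c -> b != c ->
  edge I c a \/ edge I c b.
Proof.
case=> d dL nEcc Ech Eab ac bc; set L := localization I [set c] in dL.
have nL0 : ~ L 'X_[0].
  case/localizationX=> i [j [Eij le0]]; apply: nEcc.
  have all_c x : (x == i) || (x == j) -> x = c.
    move=> xij; apply/eqP; apply: contraT => xc.
    have := le0 x; rewrite inE => /(_ xc); rewrite mnm0E.
    by case/orP: xij => /eqP->; rewrite eqxx; lia.
  have ic : i = c by apply: all_c; rewrite eqxx.
  have jc : j = c by apply: all_c; rewrite eqxx orbT.
  by rewrite ic jc in Eij.
have L1 v : L 'X_[v] -> v != 0%MM by move=> Lv; apply/eqP=> v0; rewrite v0 in Lv.
have hc : h != c by apply/eqP=> hc; rewrite hc in Ech.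
have d1 : d = 1%N.
  rewrite -(mdeg1 h); apply/esym/dL; split.
    apply/localizationX; exists c, h; split=> // x.
    by rewrite inE eq_sym mnm1E => /negPf->.
  move=> v /L1 v0 vh; apply: lem_mdeg_eq => //; have := mdeg_le vh.
  by rewrite mdeg1; move: v0; rewrite -mdeg_eq0; lia.
have Lab : L 'X_[U_(a) + U_(b)].
  by apply/localizationX; exists a, b; split=> // x _; rewrite mnmDE !mnm1E.
have [v mv vab] := exists_min_gen Lab.
have [q /eqP vq] := mdeg1P _ (introT eqP (etrans (dL v mv) d1)).
case: mv => Lv _; rewrite {}vq in Lv vab.
have qab : q = a \/ q = b.
  move: vab; rewrite lep1mP mnmDE !mnm1E.
  by case: (a =P q) => [->|_]; [left | case: (b =P q) => [->|//]; right].
have qc : q != c by case: qab => ->.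
suff Ecq : edge I c q by case: qab => <-; [left | right].
have [i [j [Eij le_q]]] := (localizationX _ _).1 Lv.
have [ic|ic] := eqVneq i c; have [jc|jc] := eqVneq j c.
- by rewrite ic jc in Eij.
- have := le_q j; rewrite inE jc mnm1E eqxx => /(_ isT).
  by case: (q =P j) => [->|_]; [rewrite -ic | lia].
- have := le_q i; rewrite inE ic mnm1E eqxx => /(_ isT).
  by case: (q =P i) => [->|_]; [rewrite -jc; move=> _; apply: edgeC | lia].
have := le_q i; rewrite inE ic mnm1E eqxx => /(_ isT).
have := le_q j; rewrite inE jc mnm1E eqxx => /(_ isT).
by case: (q =P i) => [->|_]; case: (i =P j) => [->|ij]; rewrite ?eqxx //=; lia.
Qed.

(** The join of l to the edge i j follows by localizing at l, unless l has a
    loop; then by localizing at i, with l l as the surviving edge, unless i has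
    a loop too; and two loops are joined by the first syzygies. *)
Lemma linear_resolution_edge_join :
  (forall C, has_linear_resolution (localization I C)) -> edge_join I.
Proof.
move=> linI.
have single C : generated_in_single_degree (localization I C).
  have [F [d Fd]] := linI C; exists `|d|%N => u mu.
  have tor0 (e : int) : e <> d -> Tor_vanishes F 0 e.
    by move=> ed; apply: (Fd 0%N); rewrite add0r.
  by rewrite -(Tor0_min_gen (localization_monomial C mI) tor0 mu).
have loops i l : edge I i i -> edge I l l -> edge I i l.
  move=> Eii Ell; have [<-//|il] := eqVneq i l.
  have IL u : I 'X_[u] <-> localization I set0 'X_[u].
    rewrite localizationX (quadraticX mI I2).
    split=> -[a [b [Eab le_u]]]; exists a, b; split=> //.
      by move/mnm_lepP: le_u => le_u h _; rewrite -!mnm1E -mnmDE.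
    by apply/mnm_lepP=> h; rewrite mnmDE !mnm1E le_u ?inE.
  have mL := localization_monomial set0 mI.
  have [F [d Fd]] := linI set0.
  have d2 : d = 2%:Z.
    have IsL := same_monomial_ideal mI mL IL.
    have mii := same_ideal_min_gen IsL (edge_min_gen I2 Eii).
    have tor0 (e : int) : e <> d -> Tor_vanishes F 0 e.
      by move=> ed; apply: (Fd 0%N); rewrite add0r.
    by rewrite -(Tor0_min_gen mL tor0 mii) mdegD !mdeg1.
  apply/IL; apply: (Tor1_squares (F := F) mL _ il); try exact/IL.
  by apply: Fd; rewrite d2.
have nbr c h a b : edge I c h -> ~ edge I c c -> edge I a b ->
    edge I c a \/ edge I c b.
  move=> Ech nEcc Eab.
  have [ac|ac] := eqVneq a c; first (by rewrite ac in Eab; right).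
  have [bc|bc] := eqVneq b c.
    by rewrite bc in Eab; left; apply: edgeC.
  exact: single_degree_edge (single _) nEcc Ech Eab ac bc.
move=> i j l h Eij Elh; have [Ell|nEll] := classic (edge I l l); last first.
  by case: (nbr l h i j Elh nEll Eij) => /edgeC; [left | right].
left; have [Eii|nEii] := classic (edge I i i); first exact: loops.
by case: (nbr i j l l Eij nEii Ell).
Qed.

End LocalizeDegreeTwo.
End Quadratic.

(** * The explicit shape *)

Lemma exists_initial_segments n (A B : {set 'I_n}) : A \subset B ->
  exists s : 'S_n, forall i : 'I_n,
    (s i \in A) = (i < #|A|)%N /\ (s i \in B) = (i < #|B|)%N.
Proof.
move=> AB; pose l := enum A ++ enum (B :\: A) ++ enum (~: B).
have memD x : (x \in enum (B :\: A) ++ enum (~: B)) = (x \notin A).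
  rewrite mem_cat !mem_enum !inE; have := subsetP AB x.
  by case: (x \in A) (x \in B) => [] [] // /(_ isT).
have BE : #|B| = (#|A| + #|B :\: A|)%N by rewrite -(cardsID A B) (setIidPr AB).
have sz : size l == n.
  by rewrite !size_cat -!cardE addnA -BE cardsC card_ord.
have ul : uniq (Tuple sz).
  rewrite /= cat_uniq enum_uniq cat_uniq !enum_uniq andbT /=; apply/andP; split.
    by apply/hasPn=> x; rewrite memD mem_enum.
  by apply/hasPn=> x; rewrite !mem_enum !inE => /negPf->; rewrite andbF.
have /tuple_uniqP inj_l := ul; exists (perm inj_l) => i.
have il : (i < size l)%N by rewrite (eqP sz).
rewrite permE (tnth_nth i) /=; split.
  rewrite nth_cat -cardE; case: ltnP => iA.
    by rewrite -mem_enum mem_nth // -cardE.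
  apply/negbTE; rewrite -memD mem_nth //.
  by move: il; rewrite size_cat -cardE -ltn_subLR.
rewrite /l catA nth_cat size_cat -!cardE -BE; case: ltnP => iB.
  have : nth i (enum A ++ enum (B :\: A)) i \in enum A ++ enum (B :\: A).
    by rewrite mem_nth // size_cat -!cardE -BE.
  by rewrite mem_cat !mem_enum !inE => /orP[/(subsetP AB)|/andP[]].
apply/negbTE; rewrite -in_setC -mem_enum mem_nth // -cardE.
by move: il; rewrite /l catA size_cat size_cat -!cardE -BE -ltn_subLR.
Qed.

Section Shape.
Variables (K : fieldType) (n : nat).
Local Notation S := {mpoly K[n]}.
Implicit Types (I J L : S -> Prop) (u v w : 'X_{1..n}) (p q : S).
Implicit Types (i j l : 'I_n) (V W : {set 'I_n}).

Lemma ideal_mul_varE V W :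
  same_ideal (ideal_mul (@var_ideal K n V) (var_ideal W))
    (monomials_ideal (fun u => exists i j, [/\ i \in V, j \in W & u = U_(i) +
      U_(j)]%MM)).
Proof.
move=> p; split; apply: gen_ideal_sub => q.
  case=> a [b [/var_idealP Va /var_idealP Wb ->]]; apply/monomials_idealP=> u.
  case/msuppM_le/allpairsP=> -[v w] /= [/Va[i iV vi] /Wb[j jW wj] ->].
  exists (U_(i) + U_(j))%MM; first by exists i, j.
  apply/mnm_lepP=> h; rewrite !mnmDE !mnm1E leq_add //.
    by case: eqP => // <-.
  by case: eqP => // <-.
case=> _ [i [j [iV jW ->]]] ->; apply: gen_ideal_gen; exists 'X_i, 'X_j.
by split; [apply: gen_ideal_gen; exists i | apply: gen_ideal_gen; exists j
  | rewrite mpolyXD].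
Qed.

Lemma monomial_ideal0 I : monomial_ideal I -> I 0.
Proof. by case=> A /(_ 0) ->; apply: gen_ideal0. Qed.

Lemma monomial_idealD I p q : monomial_ideal I -> I p -> I q -> I (p + q).
Proof. by case=> A IA; rewrite !(IA _); apply: gen_idealD. Qed.

Lemma monomial_idealM I p q : monomial_ideal I -> I q -> I (p * q).
Proof. by case=> A IA; rewrite !(IA _); apply: gen_idealM. Qed.

Lemma ideal_add_monomialP I J p : monomial_ideal I -> monomial_ideal J ->
  (ideal_add I J p <-> forall u, u \in msupp p -> I 'X_[u] \/ J 'X_[u]).
Proof.
move=> mI mJ; split=> [[a [b [Ia Jb ->]]] u|IJ].
  move/msuppD_le; rewrite mem_cat => /orP[ua|ub].
    by left; apply: (monomial_ideal_supp a mI).1.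
  by right; apply: (monomial_ideal_supp b mJ).1.
rewrite [p]mpolyE big_seq; apply: big_ind.
- by exists 0, 0; rewrite addr0; split=> //; apply: monomial_ideal0.
- move=> _ _ [a [b [Ia Jb ->]]] [a' [b' [Ia' Jb' ->]]].
  exists (a + a'), (b + b'); split; last by rewrite addrACA.
    exact: monomial_idealD.
  exact: monomial_idealD.
move=> u /IJ; rewrite -mul_mpolyC => -[Iu|Ju].
  exists ((p@_u)%:MP * 'X_[u]), 0; rewrite addr0; split=> //.
    exact: monomial_idealM.
  exact: monomial_ideal0.
exists 0, ((p@_u)%:MP * 'X_[u]); rewrite add0r; split=> //.
  exact: monomial_ideal0.
exact: monomial_idealM.
Qed.

Lemma ideal_add_monomialX I J u : monomial_ideal I -> monomial_ideal J ->
  (ideal_add I J 'X_[u] <-> I 'X_[u] \/ J 'X_[u]).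
Proof.
move=> mI mJ; rewrite ideal_add_monomialP // msuppX.
by split=> [|IJ v]; [apply; rewrite inE | rewrite inE => /eqP->].
Qed.

Lemma supp_monomial_ideal I (A : 'X_{1..n} -> Prop) :
  (forall u v, A u -> (u <= v)%MM -> A v) ->
  (forall p, I p <-> forall u, u \in msupp p -> A u) -> monomial_ideal I.
Proof.
move=> upA IA; exists A => p; rewrite IA monomials_idealP.
split=> Ap u /Ap; first by exists u; rewrite ?lepm_refl.
by case=> a Aa /(upA _ _ Aa).
Qed.

Lemma ideal_add_monomial I J :
  monomial_ideal I -> monomial_ideal J -> monomial_ideal (ideal_add I J).
Proof.
move=> mI mJ; apply: (supp_monomial_ideal (A := fun u => I 'X_[u] \/ J 'X_[u])).
  by move=> u v [Iu|Ju] uv; [left|right];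
    [apply: monomial_ideal_up Iu uv|apply: monomial_ideal_up Ju uv].
by move=> p; apply: ideal_add_monomialP.
Qed.

Lemma relabelX (s : 'S_n) I u :
  relabel s I 'X_[u] <-> I 'X_[[multinom u ((s^-1)%g i) | i < n]].
Proof. by rewrite /relabel msymX. Qed.

Lemma relabel_monomial (s : 'S_n) I :
  monomial_ideal I -> monomial_ideal (relabel s I).
Proof.
move=> mI; apply: (supp_monomial_ideal (A := fun u => relabel s I 'X_[u])).
  move=> u v; rewrite !relabelX => Iu /mnm_lepP uv;
    apply: monomial_ideal_up Iu _ => //.
  by apply/mnm_lepP=> i; rewrite !mnmE.
move=> p; rewrite /relabel (monomial_ideal_supp _ mI); split=> Ip u up.
  rewrite msymX; apply: Ip; rewrite mcoeff_msupp mcoeff_sym.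
  rewrite mcoeff_msupp in up; congr (_@__ != 0): up.
  by apply/mnmP=> i; rewrite !mnmE permK.
have := Ip [multinom u (s i) | i < n]; rewrite msymX.
rewrite mcoeff_msupp -mcoeff_sym -mcoeff_msupp => /(_ up).
by congr (I 'X_[_]); apply/mnmP=> i; rewrite !mnmE permKV.
Qed.

Lemma relabel_edge (s : 'S_n) I i j : edge (relabel s I) i j <-> edge I (s i) (s j).
Proof.
rewrite /edge relabelX; have -> // : [multinom (U_(i) + U_(j))%MM ((s^-1)%g h)
  | h < n]
  = (U_(s i) + U_(s j))%MM.
apply/mnmP=> h; rewrite mnmE !mnmDE !mnm1E.
by rewrite !(can2_eq (permK s) (permKV s)).
Qed.

Section DegreeTwo.
Variable I : S -> Prop.
Hypotheses (mI : monomial_ideal I) (I2 : generated_in_degree 2 I).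

Lemma relabel_degree (s : 'S_n) : generated_in_degree 2 (relabel s I).
Proof.
move=> u [/relabelX Iu minu].
have [i [j [Eij /mnm_lepP le_u]]] := (quadraticX mI I2 _).1 Iu.
suff <- : (U_((s^-1)%g i) + U_((s^-1)%g j))%MM = u by rewrite mdegD !mdeg1.
apply: minu; first by apply/relabel_edge; rewrite !permKV.
apply/mnm_lepP=> h; have := le_u (s h); rewrite !mnmDE !mnm1E mnmE permK.
by rewrite !(can2_eq (permKV s) (permK s)).
Qed.

(** As I has no generators in degree less than 2, any edge found in J is itself
    among the squarefree generators of J; so its ends lie in the range of J. *)
Lemma degree2_shape_edge_join : degree2_shape I -> edge_join I.
Proof.
case=> s [k [m [/andP[km mn] [J [[A JA sqA] IJ propJ]]]]].
set V := [set i : 'I_n | (k <= i < m)%N] in sqA.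
set M := ideal_mul _ _ in IJ.
have mM : monomial_ideal M by eexists; apply: ideal_mul_varE.
have mJ : monomial_ideal J by exists A.
have mR := relabel_monomial s mI; have R2 := @relabel_degree s.
have edgeJ i j : edge J i j -> i \in V /\ j \in V.
  rewrite /edge (JA _) monomials_idealX => -[a Aa le_a].
  have Ra : relabel s I 'X_[a].
    by apply/IJ/ideal_add_monomialX => //; right; apply/JA/monomials_idealX;
      exists a; rewrite ?lepm_refl.
  have ea : a = (U_(i) + U_(j))%MM.
    apply: (lem_mdeg_eq le_a); apply/eqP; rewrite eqn_leq mdeg_le //.
    by rewrite mdegD !mdeg1 (generated_in_degree_le R2 Ra).
  have inV h : (0 < a h)%N -> h \in V.
    by have [_ aV] := sqA a Aa h; apply: contraTT => /aV->.
  by split; apply: inV; rewrite ea mnmDE !mnm1E eqxx ?addn1.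
have edgeR i j : edge (relabel s I) i j <->
    (i < k)%N && (j < m)%N || (j < k)%N && (i < m)%N \/ edge J i j.
  rewrite /edge (IJ _) ideal_add_monomialX //.
  rewrite /M (ideal_mul_varE _ _ 'X_[_]) monomials_idealX.
  split=> -[|Jij]; try by right.
    case=> _ [a [b [+ + ->]]] le_ab; rewrite !inE => ak bm; left.
    have eab : (U_(a) + U_(b))%MM = (U_(i) + U_(j))%MM :> 'X_{1..n}.
      by apply: lem_mdeg_eq; rewrite // !mdegD !mdeg1.
    have /mnmP/(_ a) := eab; have /mnmP/(_ b) := eab; rewrite !mnmDE !mnm1E !eqxx.
    have [ia|ia] := eqVneq i a.
      have [jb|jb] := eqVneq j b; first by rewrite ia jb ak bm.
      by rewrite ia; case: (a == b); lia.
    have [ja|ja] := eqVneq j a; last by lia.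
    have [ib _ _|ib] := eqVneq i b; first by rewrite ja ib ak bm orbT.
    by rewrite ja; case: (a == b); lia.
  move=> ij; left; case/orP: ij => /andP[ak bm].
    by exists (U_(i) + U_(j))%MM; [exists i, j; rewrite !inE | apply: lepm_refl].
  exists (U_(j) + U_(i))%MM; first by exists j, i; rewrite !inE.
  by rewrite addmC lepm_refl.
suff joinR : edge_join (relabel s I).
  move=> i j l h; have := joinR ((s^-1)%g i) ((s^-1)%g j) ((s^-1)%g l) ((s^-1)%g h).
  by rewrite !relabel_edge !permKV.
move=> i j l h /edgeR Eij /edgeR Elh; rewrite !edgeR.
have lm : (l < m)%N.
  case: Elh => [|/edgeJ[]]; last by rewrite inE => /andP[].
  by case/orP=> /andP[lt1 lt2] //; apply: leq_trans lt1 km.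
have [ik|ki] := ltnP i k; first by left; left; rewrite lm.
have [jk|kj] := ltnP j k; first by right; left; rewrite lm.
case: Eij => [|Jij]; first by rewrite !ltnNge ki kj.
have [iV jV] := edgeJ i j Jij; move: iV jV; rewrite ![_ \in V]inE.
move=> /andP[_ im] /andP[_ jm].
have [lk|kl] := ltnP l k; first by left; left; rewrite im orbT.
have [li|li] := eqVneq l i; first by right; right; rewrite li; apply: edgeC.
have [lj|lj] := eqVneq l j; first by left; right; rewrite lj.
have := propJ i j l; rewrite -!mpolyXD kl lm => /(_ Jij isT li lj).
by case; [left; right | right; right].
Qed.

(** The first k variables are those with a loop, the first m the non-isolated
    ones, and J collects the edges between vertices without loop; these are
    squarefree for that reason. *)
Lemma edge_join_degree2_shape : edge_join I -> degree2_shape I.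
Proof.
move=> joinI.
have [loop loopP] := finite_decidable (fun i : 'I_n => edge I i i).
have [vert vertP] := finite_decidable (fun i : 'I_n => exists j, edge I i j).
have [|s sP] := @exists_initial_segments n [set i | loop i] [set i | vert i].
  by apply/subsetP=> i; rewrite !inE => /loopP Eii; apply/vertP; exists i.
set k := #|[set i | loop i]| in sP; set m := #|[set i | vert i]| in sP.
have loopE i : edge I (s i) (s i) <-> (i < k)%N.
  by rewrite -(sP i).1 inE; split=> /loopP.
have vertE i : (exists j, edge I (s i) j) <-> (i < m)%N.
  by rewrite -(sP i).2 inE; split=> /vertP.
exists s, k, m; split.
  rewrite (leq_trans (max_card _) (eq_leq (card_ord n))) andbT.
  apply: subset_leq_card.
  by apply/subsetP=> i; rewrite !inE => /loopP Eii; apply/vertP; exists i.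
pose A u := exists i j : 'I_n, [/\ (k <= i < m)%N, (k <= j < m)%N,
  edge I (s i) (s j) & u = (U_(i) + U_(j))%MM].
pose J := @monomials_ideal K n A.
have mJ : monomial_ideal J by exists A.
exists J; split.
- exists A => //.
  move=> _ [i [j [im jm Eij ->]]] h; have ij : i != j.
    by apply/eqP=> ij; rewrite -ij in Eij; move/loopE: Eij; lia.
  rewrite mnmDE !mnm1E inE; split=> [|hV].
    case: (i =P h) ij => [->|_ _]; last by case: (j == h).
    by rewrite eq_sym => /negPf->.
  case: (i =P h) hV => [<-|_]; first by rewrite im.
  by case: (j =P h) => [<-|//]; rewrite jm.
- have mM V W : monomial_ideal (ideal_mul (@var_ideal K n V) (var_ideal W)).
    by eexists; apply: ideal_mul_varE.
  apply: same_monomial_ideal; first exact: relabel_monomial.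
    exact: ideal_add_monomial.
  move=> u; rewrite ideal_add_monomialX // (ideal_mul_varE _ _ 'X_[_])
    monomials_idealX.
  rewrite (quadraticX (relabel_monomial s mI) (@relabel_degree s)).
  split=> [[i [j [/relabel_edge Eij le_u]]]|].
    have im : (i < m)%N by apply/vertE; exists (s j).
    have jm : (j < m)%N by apply/vertE; exists (s i); apply: edgeC.
    have [ik|ki] := ltnP i k.
      by left; exists (U_(i) + U_(j))%MM => //; exists i, j; rewrite !inE.
    have [jk|kj] := ltnP j k.
      left; exists (U_(j) + U_(i))%MM; last by rewrite addmC.
      by exists j, i; rewrite !inE.
    right; apply/monomials_idealX; exists (U_(i) + U_(j))%MM => //.
    by exists i, j; rewrite ki kj.
  case=> [[_ [i [j [+ + ->]]] le_u]|/monomials_idealX[_ [i [j [_ _ Eij ->]]] le_u]].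
    rewrite !inE => /loopE Eii /vertE[h Ejh]; exists i, j; split=> //.
    by apply/relabel_edge; case: (joinI _ _ _ _ Eii Ejh).
  by exists i, j; split=> //; apply/relabel_edge.
move=> i j l; rewrite -!mpolyXD => Jij klm li lj.
have [im jm Eij] : [/\ (k <= i < m)%N, (k <= j < m)%N & edge I (s i) (s j)].
  have [_ [a [b [am bm Eab ->]]] le_ab] := (monomials_idealX _ _ _).1 Jij.
  have eab : (U_(a) + U_(b))%MM = (U_(i) + U_(j))%MM :> 'X_{1..n}.
    by apply: lem_mdeg_eq; rewrite // !mdegD !mdeg1.
  have inab h : (h == i) || (h == j) -> (k <= h < m)%N.
    move=> hij; have /mnmP/(_ h) := eab; rewrite !mnmDE !mnm1E.
    rewrite ![_ == h]eq_sym; case: (h =P a) => [->//|_]; case: (h =P b) => [->//|_].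
    by case/orP: hij => ->; lia.
  split; [by apply: inab; rewrite eqxx | by apply: inab; rewrite eqxx orbT |].
  by apply/relabel_edge; rewrite /edge -eab; apply/relabel_edge.
have /andP[_ /vertE[h Elh]] := klm.
have JX (a b : 'I_n) : (k <= a < m)%N -> (k <= b < m)%N -> edge I (s a) (s b) ->
    J 'X_[U_(a) + U_(b)].
  move=> am bm Eab; apply/monomials_idealX; exists (U_(a) + U_(b))%MM;
    last exact: lepm_refl.
  by exists a, b.
by case: (joinI _ _ _ _ Eij Elh) => E; [left | right]; apply: JX.
Qed.

End DegreeTwo.
End Shape.

Theorem proposition2p1 (K : fieldType) (n : nat) (I : {mpoly K[n]} -> Prop)
    (I_monomial : monomial_ideal I) (I_deg2 : generated_in_degree 2 I) :
  [<-> polymatroidal I;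
       forall C : {set 'I_n}, polymatroidal (localization I C);
       forall C : {set 'I_n},
         generated_in_single_degree (localization I C) /\
         revlex_linear_quotients (localization I C);
       forall C : {set 'I_n}, has_linear_resolution (localization I C);
       degree2_shape I].
Proof.
split; last (split; last (split; last split)).
- by move=> polyI C; apply/edge_join_localization/polymatroidal_edge_join.
- by move=> polyIC C; split; [case: (polyIC C) | apply: polymatroidal_revlex].
- move=> linIC C; have [[d dL] [mL [s _ sL]]] := linIC C.
  exact: linear_quotients_resolution mL dL sL.
- by move=> resIC; apply/edge_join_degree2_shape/linear_resolution_edge_join.
by move=> shapeI; apply/edge_join_polymatroidal/degree2_shape_edge_join.
Qed.
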